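(* Let $X$ be the Coxeter graph of type $B_n$, and let $W=W(B_n)$, $W_c=W_c(B_n)$, $\mathcal{H}=\mathcal{H}(B_n)$, $\mathcal{J}=\mathcal{J}(B_n)$, $\theta:\mathcal{H}\to\mathcal{TL}(B_n)=\mathcal{H}/\mathcal{J}$. Then all of the following (mutually equivalent) conditions are satisfied: (i) The ideal $\mathcal{J}$ is spanned (over $\mathcal{A}$) by those elements $C'_w$ that it contains. (ii) The ideal $\mathcal{J}$ is spanned (over $\mathcal{A}$) by the set $\{C'_w : w\in W\setminus W_c\}$. (iii) For each $w\in W\setminus W_c$, one has $\theta(C'_w)=0$. (iv) If $w\in W$, then $\theta(C'_w)\in\mathcal{L}$, and $\pi(\theta(C'_w))=\pi(c_w)$ if $w\in W_c$, while $\pi(\theta(C'_w))=0$ otherwise. (v) For each $w\in W\setminus W_c$, one has $\theta(\widetilde{T}_w)\in v^{-1}\mathcal{L}$. (vi) The set $W\setminus W_c$ is closed under $\leq_L$ and so is a union of left cells. (vii) The set $W\setminus W_c$ is closed under $\leq_{LR}$ and so is a union of two-sided cells. (viii) The set $W_c$ is closed under $\geq_{LR}$ and so is a union of two-sided cells. In particular, the set $W_c(B_n)$ is closed under $\geq_{LR}$ and so is a union of two-sided Kazhdan--Lusztig cells.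
   Context: $W(B_n)$ is the Coxeter group with generating involutions $S=\{\sigma_1,\dots,\sigma_n\}$, where $\sigma_1\sigma_2$ has order $4$, $\sigma_i\sigma_{i+1}$ has order $3$ for $i>1$, and all other pairs of distinct generators commute. Let $\mathcal{A}=\mathbb{Z}[v,v^{-1}]$, $\mathcal{A}^-=\mathbb{Z}[v^{-1}]$, $q=v^2$. $W$ has length function $\ell$ and Bruhat--Chevalley order $<$. Hecke algebra: $\mathcal{H}$ is the $\mathcal{A}$-algebra with $\mathcal{A}$-basis $\{T_w:w\in W\}$ and, for $s\in S$, $T_sT_w=T_{sw}$ if $\ell(sw)>\ell(w)$, $T_sT_w=qT_{sw}+(q-1)T_w$ if $\ell(sw)<\ell(w)$. Put $\widetilde{T}_w=v^{-\ell(w)}T_w$. The bar involution on $\mathcal{A}$ is the ring involution exchanging $v$ and $v^{-1}$; on $\mathcal{H}$ it is $\overline{\sum_w a_wT_w}=\sum_w\overline{a_w}\,T_{w^{-1}}^{-1}$. The Kazhdan--Lusztig basis $\{C'_w\}$ is the unique $\mathcal{A}$-basis with $\overline{C'_w}=C'_w$ and $C'_w=\sum_x\widetilde{P}_{x,w}\widetilde{T}_x$, where $\widetilde{P}_{x,w}\in\mathcal{A}^-$, $\widetilde{P}_{w,w}=1$, $\widetilde{P}_{x,w}=0$ if $x\not\leq w$, and $\widetilde{P}_{x,w}\in v^{-1}\mathcal{A}^-$ if $x<w$. Cells: $x\leq_L w$ means there is a chain $x=x_0,x_1,\dots,x_r=w$ (possibly $r=0$) such that for each $i<r$, $C'_{x_i}$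 occurs with nonzero coefficient in the expansion of $C'_sC'_{x_{i+1}}$ in the basis $\{C'_y\}$ for some $s\in S$ with $sx_{i+1}>x_{i+1}$. Define $x\leq_R w\iff x^{-1}\leq_L w^{-1}$, and let $\leq_{LR}$ be the preorder generated by $\leq_L$ and $\leq_R$. Left, right and two-sided cells are the equivalence classes of the equivalence relations $\sim_L,\sim_R,\sim_{LR}$ associated with these preorders ($x\sim w$ iff $x\leq w$ and $w\leq x$). For a preorder $\leq_\Lambda$ on a set $\Lambda$, a subset $\Lambda'$ is closed under $\leq_\Lambda$ if $\lambda_1\in\Lambda'$, $\lambda_2\in\Lambda$, $\lambda_2\leq_\Lambda\lambda_1$ imply $\lambda_2\in\Lambda'$; closedness under $\geq_{LR}$ is this notion for the opposite preorder. Fully commutative elements: a product $w_1\cdots w_m$ is reduced if $\ell(w_1\cdots w_m)=\sum\ell(w_i)$. An element $w\in W$ is fully commutative if it cannot be written as a reduced product $x_1w_{ss'}x_2$ with $w_{ss'}$ the longest element of a parabolic subgroup $\langle s,s'\rangle$ where $s,s'\in S$ do not commute. $W_c$ is the set of fully commutative elements. Generalized Temperley--Lieb algebra: $\mathcal{J}$ is the two-sided ideal of $\mathcal{H}$ generated by the elements $\sum_{w\in\langle s,s'\rangle}T_w$, over all pairs of non-commuting $s,s'\in S$. $\mathcal{TL}(B_n)=\mathcal{H}/\mathcal{J}$ and $\theta$ is the quotient map. Put $t_w=\theta(T_w)$, $\widetilde{t}_w=v^{-\ell(w)}t_w$. It is known that $\{t_w:w\in W_c\}$ is an $\mathcal{A}$-basis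 of $\mathcal{TL}(B_n)$, and that the bar involution of $\mathcal{H}$ induces a ring involution $\overline{\phantom{x}}$ on $\mathcal{TL}(B_n)$. $\mathcal{L}$ is the free $\mathcal{A}^-$-submodule of $\mathcal{TL}(B_n)$ with basis $\{\widetilde{t}_w:w\in W_c\}$, and $\pi:\mathcal{L}\to\mathcal{L}/v^{-1}\mathcal{L}$ is the canonical projection. The canonical basis $\{c_w:w\in W_c\}$ is the (known to exist) unique $\mathcal{A}^-$-basis of $\mathcal{L}$ with $\overline{c_w}=c_w$ and $\pi(c_w)=\pi(\widetilde{t}_w)$ for all $w\in W_c$. *)

(* Defs.v *)
(* Written over Mathematical Components; Laurent polynomials are carried by the
   finitely supported maps {malg int[int]} of multinomials.                   *)
From HB Require Import structures.
From mathcomp Require Import all_boot all_order all_fingroup all_algebra.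
From mathcomp Require Import finmap.
From mathcomp.multinomials Require Import monalg.

Set Implicit Arguments.
Unset Strict Implicit.
Unset Printing Implicit Defensive.

Import GRing.Theory Num.Theory.

Local Open Scope fset_scope.
Local Open Scope ring_scope.

(* a@_k is the coefficient of v^k in a.  The product of malg asks for a monoid
   of exponents without nontrivial inverses, so the convolution product along
   the additive group int is defined here.                                    *)
Definition laurent : Type := {malg int[int]}.
HB.instance Definition _ := GRing.Zmodule.on laurent.

Definition vX (k : int) : laurent := << k >>.

Section LaurentRing.

Implicit Types a b c : laurent.

Definition lmul a b : laurent :=
  \sum_(i <- msupp a) \sum_(j <- msupp b) << a@_i * b@_j *g i + j >>.

Lemma lmulEw (d1 d2 : {fset int}) a b :
    msupp a `<=` d1 -> msupp b `<=` d2 ->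
  lmul a b = \sum_(i <- d1) \sum_(j <- d2) << a@_i * b@_j *g i + j >>.
Proof.
move=> le_d1 le_d2; rewrite /lmul (big_fset_incl _ le_d1) /=.
  apply/eq_bigr=> i _; apply/big_fset_incl => // k _ /mcoeff_outdom ->.
  by rewrite mulr0 monalgU0.
move=> k _ /mcoeff_outdom ak.
by rewrite big1 => // j _; rewrite ak mul0r monalgU0.
Qed.

Lemma lmulC : commutative lmul.
Proof.
move=> a b; rewrite /lmul exchange_big /=; apply/eq_bigr=> i _.
by apply/eq_bigr=> j _; rewrite mulrC addrC.
Qed.

Lemma lmul0 : left_zero 0 lmul.
Proof. by move=> a; rewrite /lmul msupp0 big_seq_fset0. Qed.

Lemma lmulr0 : right_zero 0 lmul.
Proof. by move=> a; rewrite lmulC lmul0. Qed.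

Lemma lmulUg x k a :
  lmul << x *g k >> a = \sum_(j <- msupp a) << x * a@_j *g k + j >>.
Proof.
rewrite (lmulEw msuppU_le (fsubset_refl _)) big_seq_fset1.
by apply/eq_bigr => j _; rewrite mcoeffUU.
Qed.

Lemma lmulUU x y k l :
  lmul << x *g k >> << y *g l >> = << x * y *g k + l >>.
Proof. by rewrite (lmulEw msuppU_le msuppU_le) !big_seq_fset1 !mcoeffUU. Qed.

Lemma lmulEl a b : lmul a b = \sum_(i <- msupp a) lmul << a@_i *g i >> b.
Proof. by apply/eq_bigr=> i _; rewrite lmulUg. Qed.

Lemma lmulEr a b : lmul a b = \sum_(j <- msupp b) lmul a << b@_j *g j >>.
Proof. by rewrite lmulC lmulEl; apply/eq_bigr=> j _; rewrite lmulC. Qed.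

Lemma lmul1 : left_id (vX 0) lmul.
Proof.
move=> a; rewrite lmulUg [RHS]monalgE.
by apply/eq_bigr=> k _; rewrite mul1r add0r.
Qed.

Lemma lmulDl : left_distributive lmul +%R.
Proof.
move=> a b c.
rewrite (lmulEw (msuppD_le _ _) (fsubset_refl _)).
rewrite (lmulEw (fsubsetUl (msupp a) (msupp b)) (fsubset_refl _)).
rewrite (lmulEw (fsubsetUr (msupp a) (msupp b)) (fsubset_refl _)).
rewrite -big_split /=; apply/eq_bigr=> i _.
rewrite -big_split /=; apply/eq_bigr=> j _.
by rewrite mcoeffD mulrDl monalgUD.
Qed.

Lemma lmulDr : right_distributive lmul +%R.
Proof. by move=> a b c; rewrite !(lmulC a) lmulDl. Qed.

Lemma lmulA : associative lmul.
Proof.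
move=> a b c.
rewrite [RHS](big_morph (lmul^~ _) (fun _ _ => lmulDl _ _ _) (lmul0 _)).
rewrite lmulEl; apply/eq_bigr=> i _.
rewrite [LHS](big_morph (lmul _) (fun _ _ => lmulDr _ _ _) (lmulr0 _)).
rewrite [RHS](big_morph (lmul^~ _) (fun _ _ => lmulDl _ _ _) (lmul0 _)).
apply/eq_bigr=> j _.
rewrite [LHS](big_morph (lmul _) (fun _ _ => lmulDr _ _ _) (lmulr0 _)).
by rewrite lmulEr; apply/eq_bigr=> k _; rewrite !lmulUU mulrA addrA.
Qed.

Lemma laurent1_neq0 : vX 0 != 0.
Proof. by apply/eqP/malgP=> /(_ 0) /eqP; rewrite mcoeffUU mcoeff0. Qed.

End LaurentRing.

HB.instance Definition _ := GRing.Zmodule_isComNzRing.Build laurent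
  lmulA lmulC lmul1 lmulDl laurent1_neq0.

Lemma vX0 : vX 0 = 1. Proof. by []. Qed.

Lemma vXD k l : vX (k + l) = vX k * vX l.
Proof. by rewrite [RHS]lmulUU mulr1. Qed.

Definition v : laurent := vX 1.
Definition q : laurent := v ^+ 2.

Definition barA (a : laurent) : laurent :=
  \sum_(k <- msupp a) << a@_k *g - k >>.

Lemma barAE a k : (barA a)@_k = a@_(- k).
Proof.
rewrite {2}[a]monalgE /barA !raddf_sum /=; apply: eq_bigr => i _.
by rewrite !mcoeffU eqr_oppLR.
Qed.

Lemma barAU x k : barA << x *g k >> = << x *g - k >>.
Proof. by apply/malgP => l; rewrite barAE !mcoeffU eqr_oppLR. Qed.

Lemma barA_is_additive : zmod_morphism barA.
Proof. by move=> a b; apply/malgP => k; rewrite !(barAE, mcoeffB). Qed.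

HB.instance Definition _ :=
  GRing.isZmodMorphism.Build laurent laurent barA barA_is_additive.

Lemma barA_is_monoid_morphism : monoid_morphism barA.
Proof.
split=> [|a b]; first exact: (barAU 1 0).
rewrite [a * b]/(lmul a b) /lmul [RHS]mulr_suml raddf_sum /=.
apply: eq_bigr => i _; rewrite mulr_sumr raddf_sum /=; apply: eq_bigr => j _.
by rewrite barAU opprD -lmulUU.
Qed.

HB.instance Definition _ :=
  GRing.isMonoidMorphism.Build laurent laurent barA barA_is_monoid_morphism.

Lemma barA_v : barA v = vX (- 1). Proof. exact: barAU. Qed.

Lemma barAK : involutive barA.
Proof. by move=> a; apply/malgP => k; rewrite !barAE opprK. Qed.

(* A^- = Z[v^-1] *)
Definition in_Aneg (a : laurent) : Prop := forall k : int, 0 < k -> a@_k = 0.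

Definition in_vAneg (a : laurent) : Prop :=
  exists2 b, in_Aneg b & a = vX (- 1) * b.

(* The group presented by the generators gen i and the relations
   (gen i gen j)^(m i j) = 1, characterized by its universal property among all
   groups; m i i = 1 makes the generators involutions.  The carrier is finite,
   which is no restriction for the matrix mB below.                           *)
Record coxeter_system (n : nat) (m : 'I_n -> 'I_n -> nat) := CoxeterSystem {
  cox_group :> finGroupType;
  gen : 'I_n -> cox_group;
  gen_generates : (<<[set gen i | i : 'I_n]>> = [set: cox_group])%g;
  gen_rel : forall i j, ((gen i * gen j) ^+ m i j = 1)%g;
  gen_univ : forall (K : groupType) (t : 'I_n -> K),
    (forall i j, (t i * t j) ^+ m i j = 1)%g ->
    exists2 f : cox_group -> K,
      {morph f : x y / (x * y)%g} & forall i, f (gen i) = t i }.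

(* Generators sigma_1, ..., sigma_n are indexed from 0, so the edge labelled 4
   joins the indices 0 and 1.                                                 *)
Definition mB (n : nat) (i j : 'I_n) : nat :=
  (if i == j then 1
   else if (i.+1 == j :> nat) || (j.+1 == i :> nat) then
     if minn i j == 0 then 4 else 3
   else 2)%N.

Section Coxeter.

Variables (n : nat) (m : 'I_n -> 'I_n -> nat) (W : coxeter_system m).
Implicit Types w x y : W.

Definition word_of (k : nat) w : bool :=
  [exists e : k.-tuple 'I_n, (\prod_(i <- e) gen W i)%g == w].

Lemma word_ex w : exists k, word_of k w.
Proof.
have /gen_prodgP[k [c cS ->]] : (w \in <<[set gen W i | i : 'I_n]>>)%g.
  by rewrite gen_generates inE.
have /fin_all_exists[e ce] : forall j : 'I_k, exists i, c j = gen W i.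
  by move=> j; have /imsetP[i _ ->] := cS j; exists i.
exists k; apply/existsP; exists [tuple e j | j < k].
by rewrite big_tuple; apply/eqP/eq_bigr => j _; rewrite tnth_mktuple ce.
Qed.

Definition ell w : nat := ex_minn (word_ex w).

Definition reflections : {set W} :=
  [set (gen W i ^ w)%g | i : 'I_n, w : W].

(* Bruhat-Chevalley order, generated by x < x t for t a reflection with
   ell x < ell (x t).                                                         *)
Definition bruhat_step x y : bool :=
  [exists t in reflections, (y == x * t)%g] && (ell x < ell y)%N.

Definition bruhat_le : rel W := connect bruhat_step.
Definition bruhat_lt x y : bool := (x != y) && bruhat_le x y.

Definition noncommuting (i j : 'I_n) : bool :=
  (gen W i * gen W j != gen W j * gen W i)%g.

Definition parabolic2 (i j : 'I_n) : {set W} :=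
  (<<[set gen W i; gen W j]>>)%g.

Definition longest (P : {set W}) w : bool :=
  (w \in P) && [forall u in P, (ell u <= ell w)%N].

Definition fully_commutative w : bool :=
  ~~ [exists i, exists j, exists x1 : W, exists u : W, exists x2 : W,
      [&& noncommuting i j, longest (parabolic2 i j) u,
          (w == x1 * u * x2)%g & (ell w == ell x1 + ell u + ell x2)%N]].

Definition Wc : {set W} := [set w | fully_commutative w].

End Coxeter.

Section Cells.

Variables (T : finType) (r : rel T).

Definition closed_under (D : {set T}) : Prop :=
  forall x y, x \in D -> r y x -> y \in D.

Definition cells : {set {set T}} :=
  [set [set y | r x y && r y x] | x : T].

Definition union_of_cells (D : {set T}) : Prop :=
  exists2 P : {set {set T}}, P \subset cells & D = cover P.

End Cells.

Definition lin_span (R : pzRingType) (K : R -> Prop) (M : lmodType R)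
    (S : M -> Prop) (x : M) : Prop :=
  exists2 s : seq (R * M),
    forall p, p \in s -> K p.1 /\ S p.2 & x = \sum_(p <- s) p.1 *: p.2.

Record basis (R : pzRingType) (M : lmodType R) (I : finType) := Basis {
  bvec :> I -> M;
  coord : M -> I -> R;
  coordK : forall x, \sum_i coord x i *: bvec i = x;
  bvecK : forall (a : I -> R) i, coord (\sum_j a j *: bvec j) i = a i }.

Definition two_sided_ideal (R : pzRingType) (J : R -> Prop) : Prop :=
  [/\ J 0, forall x y, J x -> J y -> J (x + y)
    & forall a x b, J x -> J (a * x * b)].

Definition ideal_generated (R : pzRingType) (S : R -> Prop) (x : R) : Prop :=
  forall J : R -> Prop, two_sided_ideal J -> (forall y, S y -> J y) -> J x.

(* unitAlgType rather than algType only serves to write inverses.  The rules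
   hecke_up and hecke_down leave heckeT 1 = 1 undetermined when n = 0.        *)
Record hecke_algebra (n : nat) (m : 'I_n -> 'I_n -> nat)
    (W : coxeter_system m) := HeckeAlgebra {
  hecke_alg :> unitAlgType laurent;
  heckeT : basis hecke_alg W;
  hecke1 : heckeT 1%g = 1;
  hecke_up : forall i w, (ell w < ell (gen W i * w)%g)%N ->
    heckeT (gen W i) * heckeT w = heckeT (gen W i * w)%g;
  hecke_down : forall i w, (ell (gen W i * w)%g < ell w)%N ->
    heckeT (gen W i) * heckeT w =
      q *: heckeT (gen W i * w)%g + (q - 1) *: heckeT w }.

Section Hecke.

Variables (n : nat) (m : 'I_n -> 'I_n -> nat) (W : coxeter_system m).
Variable (H : hecke_algebra W).

Definition Ttilde (w : W) : H := vX (- (ell w)%:Z) *: heckeT H w.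

Definition barH (h : H) : H :=
  \sum_(w : W) barA (coord (heckeT H) h w) *: (heckeT H w^-1%g)^-1.

Definition is_KL_basis (C : basis H W) : Prop :=
  forall w : W, barH (C w) = C w /\
    exists P : W -> laurent,
      [/\ C w = \sum_(x : W) P x *: Ttilde x,
          forall x, in_Aneg (P x),
          P w = 1,
          forall x, ~~ bruhat_le x w -> P x = 0
        & forall x, bruhat_lt x w -> in_vAneg (P x)].

Section Preorders.

Variable C : basis H W.

Definition left_step (x w : W) : bool :=
  [exists i, bruhat_lt w (gen W i * w)%g &&
             (coord C (C (gen W i) * C w) x != 0)].

Definition leL : rel W := connect left_step.
Definition leR : rel W := fun x w => leL x^-1%g w^-1%g.
Definition leLR : rel W := connect (fun x w => leL x w || leR x w).
Definition geLR : rel W := fun x w => leLR w x.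

End Preorders.

Definition J_generator (h : H) : Prop :=
  exists i j, noncommuting W i j /\ h = \sum_(w in parabolic2 W i j) heckeT H w.

Definition inJ : H -> Prop := ideal_generated J_generator.

End Hecke.

(* The quotient H / J, given by its projection theta.                         *)
Record temperley_lieb (n : nat) (m : 'I_n -> 'I_n -> nat)
    (W : coxeter_system m) (H : hecke_algebra W) := TemperleyLieb {
  tl_alg :> algType laurent;
  theta : {lrmorphism H -> tl_alg};
  theta_surj : forall x, exists h, theta h = x;
  theta_ker : forall h, theta h = 0 <-> inJ h }.

Section TL.

Variables (n : nat) (m : 'I_n -> 'I_n -> nat) (W : coxeter_system m).
Variables (H : hecke_algebra W) (TL : temperley_lieb H).

Definition ttilde (w : W) : TL := vX (- (ell w)%:Z) *: theta TL (heckeT H w).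

(* The lattice L and its submodule v^-1 L *)
Definition inL : TL -> Prop :=
  lin_span in_Aneg (fun x => exists2 w, w \in Wc W & x = ttilde w).

Definition in_vL (x : TL) : Prop := exists2 y, inL y & x = vX (- 1) *: y.

(* pi x = pi y in L / v^-1 L *)
Definition pi_eq (x y : TL) : Prop := in_vL (x - y).

Definition is_induced_bar (bar : TL -> TL) : Prop :=
  forall h : H, bar (theta TL h) = theta TL (barH h).

(* Only the values of c on Wc matter.                                         *)
Definition is_canonical_basis (bar : TL -> TL) (c : W -> TL) : Prop :=
  [/\ forall x, inL x <->
        lin_span in_Aneg (fun y => exists2 w, w \in Wc W & y = c w) x,
      forall a : W -> laurent, (forall w, in_Aneg (a w)) ->
        \sum_(w in Wc W) a w *: c w = 0 -> forall w, w \in Wc W -> a w = 0,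
      forall w, w \in Wc W -> bar (c w) = c w
    & forall w, w \in Wc W -> pi_eq (c w) (ttilde w)].

End TL.

(* Main.v *)
(* Conditions (i)-(viii) all follow from (v): given (v), theta (C'_w) lies in the
   lattice L, is bar-invariant, and is congruent modulo v^-1 L to c_w or to 0; a
   bar-invariant element of v^-1 L vanishes, so theta (C'_w) is c_w or 0.

   For (v), W acts on the positions of signed permutations and a word w is not
   fully commutative iff its one-line notation has a decreasing triple at
   positions a < b < c with a <> - c.  Choosing c - a minimal shows that such
   a w either has two noncommuting left descents s, s', and then the relation
   of J expresses T~_w by shorter elements with coefficients in v^-1 A^-, or has
   a left descent s such that s w is not fully commutative and has a left descent
   s' not commuting with s.  In the latter case put x = s w and w1 = s' x.  The
   element T~_x + v^-1 T~_w1 is an eigenvector of T~_s' for the eigenvalue v, so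
   modulo higher powers of v^-1 it only involves basis elements with left descent
   s'; these do not have left descent s.  Hence in theta (T~_x) the coefficients
   of basis elements with left descent s lie in v^-2 A^-, which compensates the
   factor v produced when multiplying by T~_s.                               *)
Require Import Defs.
From mathcomp Require Import all_boot all_order all_fingroup all_algebra.
From mathcomp Require Import finmap zify.
From mathcomp.multinomials Require Import monalg.

Set Implicit Arguments.
Unset Strict Implicit.
Unset Printing Implicit Defensive.

Import Order.TTheory GRing.Theory Num.Theory.

(** * Signed permutations *)

(** Nested conditionals are evaluated from the inside: a test is decided only when its left side
    contains no further conditional. *)
Ltac decide_ifs :=
  repeat match goal with |- context [if ?a == ?b then _ else _] =>
    lazymatch a with context [if _ then _ else _] => fail
    | _ => first [ rewrite (_ : (a == b) = false); last by apply/eqP; (assumption || lia)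
                 | rewrite (_ : (a == b) = true); last by apply/eqP; lia ] end end.

Ltac split_on p l :=
  lazymatch l with
  | nil => idtac
  | cons ?a ?l' => destruct (p =P a) as [->|]; [| split_on p l']
  end.

Section Positions.

Variable n : nat.
Implicit Types (i j p q : nat) (X : nat -> nat).

(* The positions -n, ..., -1, 1, ..., n are numbered 0, ..., 2n - 1, so that negation is
   p |-> 2n - 1 - p, and s_i exchanges n + i - 1 with n + i and their negatives. *)
Definition bswap i p : nat :=
  if p == n + i - 1 then n + i else if p == n + i then n + i - 1
  else if p == n - i - 1 then n - i else if p == n - i then n - i - 1 else p.

Lemma bswapE i p : i < n ->
  (p = n + i - 1 /\ bswap i p = n + i) \/ (p = n + i /\ bswap i p = n + i - 1) \/
  (p = n - i - 1 /\ bswap i p = n - i) \/ (p = n - i /\ bswap i p = n - i - 1) \/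
  bswap i p = p.
Proof.
move=> lt_in; rewrite /bswap.
by split_on p [:: n + i - 1; n + i; n - i - 1; n - i]; decide_ifs; lia.
Qed.

Lemma bswap_lt i p : i < n -> p < 2 * n -> bswap i p < 2 * n.
Proof. by move=> lt_in; have := bswapE p lt_in; lia. Qed.

Lemma bswapK i : i < n -> involutive (bswap i).
Proof.
move=> lt_in p; rewrite /bswap.
by split_on p [:: n + i - 1; n + i; n - i - 1; n - i]; decide_ifs; lia.
Qed.

Lemma bswap_opp i p : i < n -> p < 2 * n ->
  bswap i (2 * n - 1 - p) = 2 * n - 1 - bswap i p.
Proof.
(* For [i = 0] the two exchanged pairs coincide, since [n - 1] and [n] are opposite. *)
case: i => [|i] lt_in lt_p; rewrite /bswap.
  by split_on p [:: n - 1; n]; decide_ifs; lia.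
by split_on p [:: n + i; n + i.+1; n - i.+2; n - i.+1]; decide_ifs; lia.
Qed.

Lemma bswapC i j p : i < n -> j < n -> i + 1 < j -> bswap i (bswap j p) = bswap j (bswap i p).
Proof.
case: i => [|i] *; rewrite /bswap.
  by split_on p [:: n - 1; n; n + j - 1; n + j; n - j - 1; n - j]; decide_ifs; lia.
split_on p [:: n + i; n + i.+1; n - i.+2; n - i.+1; n + j - 1; n + j; n - j - 1; n - j];
  by decide_ifs; lia.
Qed.

Lemma bswap_braid3 i p : 0 < i -> i.+1 < n ->
  bswap i (bswap i.+1 (bswap i p)) = bswap i.+1 (bswap i (bswap i.+1 p)).
Proof.
move=> *; rewrite /bswap.
split_on p [:: n + i - 1; n + i; n + i.+1; n - i - 1; n - i; n - i.+1 - 1];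
  by decide_ifs; lia.
Qed.

Lemma bswap_braid4 p : 1 < n ->
  bswap 0 (bswap 1 (bswap 0 (bswap 1 p))) = bswap 1 (bswap 0 (bswap 1 (bswap 0 p))).
Proof.
move=> *; rewrite /bswap; split_on p [:: n - 2; n - 1; n; n + 1]; decide_ifs; lia.
Qed.


(** One-line notation of a signed permutation; values are numbered like positions, so the first
    clause reads X(-p) = -X(p). *)
Definition signed X := (forall p, p < 2 * n -> X p + X (2 * n - 1 - p) = 2 * n - 1) /\
  (forall p q, p < 2 * n -> q < 2 * n -> X p = X q -> p = q).

(** For [i = 0] the positions compared are -1 and 1: for a signed [X] the value at 1 is negative. *)
Definition desc X i := X (n + i) < X (n + i - 1).

Definition triple X a b c :=
  [/\ a < b < c, c < 2 * n, X c < X b < X a & a + c + 1 <> 2 * n].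

Definition has_triple X := exists a b c, triple X a b c.

(** Index of the generator exchanging [p] and [p.+1]; in the second branch both positions are
    negative. *)
Definition position_gen p := if n <= p.+1 then p.+1 - n else n - 1 - p.

Lemma position_gen_lt p : p.+1 < 2 * n -> position_gen p < n.
Proof. by rewrite /position_gen; case: ifP; lia. Qed.

Lemma desc_position X p : signed X -> p.+1 < 2 * n ->
  desc X (position_gen p) = (X p.+1 < X p).
Proof.
move=> [X_opp _] lt_p; rewrite /desc /position_gen; case: ifP => le_np.
  by rewrite subnKC // subn1.
have := X_opp p; have := X_opp p.+1.
rewrite (_ : 2 * n - 1 - p = n + (n - 1 - p)); last by lia.
by rewrite (_ : 2 * n - 1 - p.+1 = n + (n - 1 - p) - 1); last lia; lia.
Qed.

Lemma signed_bswap X i : i < n -> signed X -> signed (X \o bswap i).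
Proof.
move=> lt_in [X_opp X_inj]; split=> [p lt_p | p q lt_p lt_q] /=.
  by rewrite bswap_opp // X_opp ?bswap_lt.
by move=> eqX; apply: (inv_inj (bswapK lt_in)); apply: X_inj eqX; exact: bswap_lt.
Qed.

Lemma bswap_position p : p.+1 < 2 * n -> bswap (position_gen p) p = p.+1.
Proof.
move=> lt_p; rewrite /bswap /position_gen; case: leqP => le_np.
  rewrite (_ : n + (p.+1 - n) - 1 = p); last by lia.
  by rewrite eqxx; lia.
rewrite (_ : n - (n - 1 - p) - 1 = p); last by lia.
by rewrite eqxx; do 2!(case: eqP => [?|_]; first by lia); lia.
Qed.

Lemma bswap_positionS p : p.+1 < 2 * n -> bswap (position_gen p) p.+1 = p.
Proof.
by move=> lt_p; rewrite -{1}(bswap_position lt_p) bswapK // position_gen_lt.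
Qed.

Lemma bswap_positionE p u : p.+1 < 2 * n -> let r := bswap (position_gen p) u in
  (u = p /\ r = p.+1) \/ (u = p.+1 /\ r = p) \/
  (u = 2 * n - 2 - p /\ r = u.+1) \/ (u = 2 * n - 1 - p /\ r.+1 = u) \/ r = u.
Proof.
move=> lt_p r; have := bswapE u (position_gen_lt lt_p); rewrite -/r; move: r => r.
rewrite /position_gen; case: leqP => le_np.
  by case=> [[? ?]|[[? ?]|[[? ?]|[[? ?]|?]]]]; [left | do 1!right; left |
    do 2!right; left | do 3!right; left | do 4!right]; lia.
by case=> [[? ?]|[[? ?]|[[? ?]|[[? ?]|?]]]]; [do 2!right; left | do 3!right; left | left |
   right; left | do 4!right]; lia.
Qed.

(** Points move by at most one step, so only the two exchanged pairs change their order. *)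
Lemma bswap_mono p u w : p.+1 < 2 * n -> u < w ->
  ~ (u = p /\ w = p.+1) -> ~ (u = 2 * n - 2 - p /\ w = 2 * n - 1 - p) ->
  bswap (position_gen p) u < bswap (position_gen p) w.
Proof.
move=> lt_p lt_uw ne1 ne2.
have := bswap_positionE w lt_p; have := bswap_positionE u lt_p.
move: (bswap _ u) (bswap _ w) => u' w'.
by case=> [[? ?]|[[? ?]|[[? ?]|[[? ?]|?]]]]; case=> [[? ?]|[[? ?]|[[? ?]|[[? ?]|?]]]]; lia.
Qed.

(** The triple is carried along by the exchange, unless two consecutive members form an exchanged
    pair. Its ends do not become opposite because the exchange commutes with negation. *)
Lemma triple_swap X p a b c : p.+1 < 2 * n -> triple X a b c ->
  ~ (a = p /\ b = p.+1) -> ~ (b = p /\ c = p.+1) ->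
  ~ (a = 2 * n - 2 - p /\ b = 2 * n - 1 - p) ->
  ~ (b = 2 * n - 2 - p /\ c = 2 * n - 1 - p) ->
  has_triple (X \o bswap (position_gen p)).
Proof.
move=> lt_p [/andP[lt_ab lt_bc] lt_c gtX not_opp] ne1 ne2 ne3 ne4.
have lt_gn := position_gen_lt lt_p.
have lt_ab' := bswap_mono lt_p lt_ab ne1 ne3.
have lt_bc' := bswap_mono lt_p lt_bc ne2 ne4; clear ne1 ne2 ne3 ne4.
exists (bswap (position_gen p) a), (bswap (position_gen p) b), (bswap (position_gen p) c).
rewrite /triple /= !bswapK // lt_ab' lt_bc'; split=> //; first exact: bswap_lt.
move=> opp; have eq_a : bswap (position_gen p) a = bswap (position_gen p) (2 * n - 1 - c).
  by rewrite bswap_opp //; lia.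
by have := inv_inj (bswapK lt_gn) eq_a; lia.
Qed.

Lemma triple_mirror X a b c : signed X -> triple X a b c ->
  triple X (2 * n - 1 - c) (2 * n - 1 - b) (2 * n - 1 - a).
Proof.
move=> [X_opp _] [lt_abc lt_c gtX not_opp].
have := X_opp a; have := X_opp b; have := X_opp c; split; lia.
Qed.

End Positions.

(** * Reduction of decreasing triples *)

Section Triples.

Variables (n : nat) (X : nat -> nat).
Hypothesis X_signed : signed n X.

(** The two alternatives of the reduction, in terms of positions: adjacent descents at [p] and [p'],
    or a triple together with a descent at [p'] after the exchange at [p]. *)
Definition reducible_at p p' := [/\ p' = p.+1 \/ p = p'.+1, p.+1 < 2 * n, p'.+1 < 2 * n,
  X p.+1 < X p &
  X p'.+1 < X p' \/
  has_triple n (X \o bswap n (position_gen n p)) /\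
  X (bswap n (position_gen n p) p'.+1) < X (bswap n (position_gen n p) p')].

Let reducible := exists p p', reducible_at p p'.

Let X_opp p : p < 2 * n -> X p + X (2 * n - 1 - p) = 2 * n - 1.
Proof. by have [] := X_signed; auto. Qed.

Let X_neq p q : p < 2 * n -> q < 2 * n -> p <> q -> X p <> X q.
Proof. by move=> lt_p lt_q ne /X_signed.2 => /(_ lt_p lt_q). Qed.

(** Exchange [c - 1] and [c]: the small value X c moves left, the triple moves along, and the value
    now to the left of X c still exceeds it. *)
Lemma reducible_right a b c : triple n X a b c -> a + c + 1 < 2 * n -> b < c - 1 ->
  (forall d, b < d < c -> X b < X d) -> reducible.
Proof.
move=> tri lt_ac lt_bc gt_b; have [lt_abc lt_c gtX _] := tri.
have [p pE] : exists p, c = p.+2 by exists c.-2; lia.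
subst c; exists p.+1, p; split; [by right | lia | lia | have := gt_b p.+1; lia | right; split].
  by apply: (triple_swap _ tri); lia.
rewrite bswap_position; last by lia.
have gtp : X p.+2 < X p.
  by case: (p =P b) => [e|?]; [rewrite {2}e; lia | have := gt_b p; lia].
have := @bswap_positionE n p.+1 p lt_c => /=.
case=> [|[|[|[|->]]]] //; try lia.
(* The mirrored exchange moves [p] only when [p], [p.+1], [p.+2] are the positions -1, 1, 2;
   antisymmetry then determines the values. *)
case=> pE rE; have pn : n = p.+1 by lia.
have -> : bswap n (position_gen n p.+1) p = p.-1 by lia.
have opp1 := X_opp lt_c; rewrite (_ : 2 * n - 1 - p.+2 = p.-1) in opp1; last by lia.
have lt_p : p < 2 * n by lia.
have opp2 := X_opp lt_p; rewrite (_ : 2 * n - 1 - p = p.+1) in opp2; last by lia.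
case: (ltngtP b p) => [lt_bp|lt_bp|bp]; first 1 last.
- by lia.
- by have := gt_b p.+1; rewrite bp in gtX *; lia.
have := gt_b p.-1.
by case: (ltngtP b p.-1) => [?|?|bp]; [lia | lia | rewrite bp in gtX *; lia].
Qed.

(** Exchange [a] and [a.+1]: the large value X a moves right and exceeds its new neighbour at
    [a.+2], which the mirrored exchange does not reach because a + c + 1 < 2n. *)
Lemma reducible_left a b c : triple n X a b c -> a + c + 1 < 2 * n -> c = b.+1 -> a.+1 < b ->
  X a.+1 < X a -> X a.+2 < X a -> reducible.
Proof.
move=> tri lt_ac cb lt_ab lt1 lt2; have [lt_abc lt_c gtX _] := tri.
exists a, a.+1; split; [by left | lia | lia | done | right; split].
  by apply: (triple_swap _ tri); lia.
rewrite bswap_positionS; last by lia.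
have := @bswap_positionE n a a.+2; move/(_ ltac:(lia)) => /=.
by case=> [|[|[|[|->]]]] //; lia.
Qed.

(** Induction on [c - a]: a badly placed intermediate value yields a shorter triple; otherwise one
    of the two preceding lemmas applies, or the three positions are consecutive. *)
Lemma triple_reducible a b c : triple n X a b c -> reducible.
Proof.
have [k] := ubnP (c - a); elim: k a b c => // k IHk a b c lt_k tri0.
(* Up to negation a + c < 0 in signed positions. Lowering [c] then never makes the ends opposite;
   only raising [a] can. *)
wlog lt_ac : a b c lt_k tri0 / a + c + 1 < 2 * n => [wlog_ac|].
  have [? ? ? ?] := tri0.
  case: (ltnP (a + c + 1) (2 * n)) => [|le_ac]; first exact: wlog_ac tri0.
  by apply: wlog_ac (triple_mirror X_signed tri0) _; lia.
have [lt_abc lt_c gtX _] := tri0.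
have gt_between b' d : triple n X a b' c -> b' < d < c -> X b' < X d \/ reducible.
  move=> [? ? gtX' ?] lt_d; have := @X_neq b' d.
  case: (ltnP (X b') (X d)) => [|le]; first by left.
  move=> ne; right; apply: (IHk a b' d); first by lia.
  by split; lia.
have lt_between d : a < d < b -> d + c + 1 <> 2 * n -> X d < X b \/ reducible.
  move=> lt_d ne_opp; have := @X_neq b d.
  case: (ltnP (X d) (X b)) => [|le]; first by left.
  move=> ne; right; apply: (IHk d b c); first by lia.
  by split; lia.
have right_case b' : triple n X a b' c -> b' < c - 1 -> reducible.
  move=> tri lt_b'; have [lt_ab'c _ _ _] := tri.
  have [all_gt|] := boolP [forall d : 'I_c, (b' < d) ==> (X b' < X d)].
    apply: (reducible_right tri lt_ac lt_b') => d /andP[lt_bd lt_dc].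
    by have /forallP/(_ (Ordinal lt_dc))/implyP/(_ lt_bd) := all_gt.
  rewrite negb_forall => /existsP[[d lt_dc]]; rewrite negb_imply /= => /andP[lt_bd nlt].
  by case: (gt_between b' d tri); rewrite ?lt_bd ?lt_dc // (negbTE nlt).
have [?|le_cb] := ltnP b (c - 1); first exact: (right_case b).
have cb : c = b.+1 by lia.
have [ab|lt_ab] := leqP b a.+1.
  have ba : b = a.+1 by lia.
  by exists a, a.+1; split; [left | lia | lia | rewrite -ba; lia | left; rewrite -ba -cb; lia].
(* At m = - c the triple (m, b, c) is excluded; if X m < X a fails, then (a, - b, c) is a
   triple to which right_case applies. *)
have opp_case m : m + c + 1 = 2 * n -> a < m < b ->
    X m < X a \/ reducible.
  move=> mE lt_m; have [|le_Xa] := ltnP (X m) (X a); first by left.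
  right; have ne := @X_neq m a.
  have opp_m : X m + X c = 2 * n - 1.
    by have := X_opp (_ : c < 2 * n); rewrite (_ : 2 * n - 1 - c = m); [lia | lia].
  have bm : 2 * n - 1 - b = m.+1 by lia.
  have opp_b : X b + X m.+1 = 2 * n - 1 by rewrite -bm X_opp; lia.
  have mb : m.+1 < b by lia.
  case: (@lt_between m.+1) => [||lt_Xm|//]; [lia | lia |].
  apply: (right_case m.+1); last by lia.
  by split; lia.
have left_case d : a < d <= b -> X d < X a \/ reducible.
  move=> lt_d; case: (d =P b) => [->|ne_db]; first by left; lia.
  case: (d + c + 1 =P 2 * n) => [opp|nopp]; first by apply: opp_case; lia.
  by case: (@lt_between d) => [||lt_X|]; [lia | lia | left; lia | right].
case: (left_case a.+1) => [|lt1|//]; first by lia.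
case: (left_case a.+2) => [|lt2|//]; first by lia.
exact: (reducible_left tri0 lt_ac cb lt_ab lt1 lt2).
Qed.

End Triples.

Definition adjacent i j := (i.+1 == j) || (j.+1 == i).

Ltac eval_bswap_in n i p q :=
  rewrite (_ : bswap n i p = q); last by rewrite /bswap; decide_ifs; lia.

(** * Triples and descents under generators *)

Section Descents.

Variable n : nat.
Implicit Types (i j k p : nat) (X : nat -> nat).

Local Notation signed := (signed n).
Local Notation desc := (desc n).
Local Notation has_triple := (has_triple n).
Local Notation bswap := (bswap n).

Lemma desc_triple X i : i.+1 < n -> desc X i -> desc X i.+1 -> has_triple X.
Proof.
rewrite /desc => lt_in d1 d2; exists (n + i - 1), (n + i), (n + i.+1).
by rewrite (_ : n + i.+1 - 1 = n + i) in d2; [split; lia | lia].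
Qed.

Lemma position_genE i : i < n -> position_gen n (n + i - 1) = i.
Proof. by rewrite /position_gen; case: ifP; lia. Qed.

(** At an ascent both exchanged pairs are increasing, so neither consists of consecutive members of
    a decreasing triple. *)
Lemma ascent_triple X i : i < n -> signed X -> has_triple X -> ~~ desc X i ->
  has_triple (X \o bswap i).
Proof.
move=> lt_in [X_opp _] [a [b [c tri]]] asc; have [lt_abc lt_c gtX _] := tri.
rewrite -[i in _ \o bswap i]position_genE //; move: asc; rewrite /desc -leqNgt.
have [p pE] : exists p, n + i = p.+1 by exists (n + i - 1); lia.
rewrite pE subn1 /= => asc; have lt_p : p.+1 < 2 * n by lia.
have opp1 := X_opp _ lt_p; have opp2 := X_opp _ (ltnW lt_p).
rewrite (_ : 2 * n - 1 - p.+1 = 2 * n - 2 - p) in opp1; last by lia.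
apply: (triple_swap lt_p tri) => -[e1 e2]; move: gtX; rewrite e1 e2; lia.
Qed.

Lemma triple_descents X : signed X -> has_triple X ->
  (exists i, [/\ i.+1 < n, desc X i & desc X i.+1]) \/
  exists i j, [/\ i < n /\ j < n, adjacent i j, desc X i, has_triple (X \o bswap i)
                & desc (X \o bswap i) j].
Proof.
move=> X_signed [a [b [c tri]]].
have [p [p' [pp' lt_p lt_p' d]]] := triple_reducible X_signed tri.
have adj : adjacent (position_gen n p) (position_gen n p').
  by rewrite /adjacent /position_gen; case: pp' => ->; do 2!case: ifP; lia.
have lt_g := position_gen_lt lt_p; have lt_g' := position_gen_lt lt_p'.
rewrite -(desc_position X_signed lt_p) in d.
case=> [d'|[tri' d']]; [left | right; exists (position_gen n p), (position_gen n p')].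
  rewrite -(desc_position X_signed lt_p') in d'.
  case/orP: adj => /eqP adj; [exists (position_gen n p) | exists (position_gen n p')];
    by rewrite adj.
by split=> //; rewrite desc_position //; exact: signed_bswap.
Qed.


Ltac eval_bswap i p q := eval_bswap_in n i p q.

(** In signed notation the hypotheses say 0 < Y(2) < -Y(1). Only triples with consecutive members -1
    and 1 are affected: (-1, 1, c) gives way to (-2, -1, c), and (a, -1, 1) to (a, 1, 2). *)
Lemma triple_swap0 Y : 1 < n -> signed Y -> Y n < Y (n - 1) ->
  Y (n + 1) < Y (n - 1) -> n <= Y (n + 1) -> has_triple Y -> has_triple (Y \o bswap 0).
Proof.
move=> n_gt1 [Y_opp Y_inj] d1 d2 ge_n [a [b [c tri]]].
have [lt_abc lt_c gtY _] := tri; have lt_p : (n - 1).+1 < 2 * n by lia.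
have lt_n : n < 2 * n by lia.
have lt_n1 : n + 1 < 2 * n by lia.
have opp := Y_opp _ lt_n; have opp1 := Y_opp _ lt_n1.
rewrite (_ : 2 * n - 1 - n = n - 1) in opp; last by lia.
rewrite (_ : 2 * n - 1 - (n + 1) = n - 2) in opp1; last by lia.
have fix_lt u : u < n - 1 -> bswap 0 u = u by move=> lt_u; eval_bswap 0 u u.
have fix_gt u : n < u -> bswap 0 u = u by move=> lt_u; eval_bswap 0 u u.
case: (a =P n - 1) => [an|na]; first case: (b =P n) => [bn|nb].
- rewrite an bn in gtY; case: (c =P n + 1) => [cn|nc]; first by rewrite cn in gtY; lia.
  exists (n - 2), (n - 1), c; rewrite /triple /= (fix_lt (n - 2)) ?(fix_gt c); try lia.
  by eval_bswap 0 (n - 1) n; split; lia.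
- by rewrite -(@position_genE 0) ?addn0; [apply: (triple_swap lt_p tri); lia | lia].
case: (b =P n - 1) => [bn|nb]; first case: (c =P n) => [cn|nc].
- rewrite bn cn in gtY; case: (a =P n - 2) => [an|na2]; first by rewrite an in gtY; lia.
  exists a, n, (n + 1); rewrite /triple /= (fix_lt a) ?(fix_gt (n + 1)); try lia.
  by eval_bswap 0 n (n - 1); split; lia.
- by rewrite -(@position_genE 0) ?addn0; [apply: (triple_swap lt_p tri); lia | lia].
by rewrite -(@position_genE 0) ?addn0; [apply: (triple_swap lt_p tri); lia | lia].
Qed.

(** In signed notation the hypotheses say -Y(1) < Y(2) < 0. A triple broken by the exchange has its
    third member at some w > 2 or w < -2, and (-1, 1, w) or (w, -1, 1) replaces it. *)
Lemma triple_swap1 Y : 1 < n -> signed Y -> Y (n + 1) < Y n ->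
  Y (n + 1) < n -> Y (n - 1) < Y (n + 1) -> has_triple Y -> has_triple (Y \o bswap 1).
Proof.
move=> n_gt1 [Y_opp Y_inj] d1 lt_n1 d2 [a [b [c tri]]].
have [lt_abc lt_c gtY _] := tri; have lt_p : n.+1 < 2 * n by lia.
have lt_p1 : n + 1 < 2 * n by lia.
have opp := Y_opp _ (ltnW lt_p); have opp1 := Y_opp _ lt_p1.
rewrite (_ : 2 * n - 1 - n = n - 1) in opp; last by lia.
rewrite (_ : 2 * n - 1 - (n + 1) = n - 2) in opp1; last by lia.
have fix_lt u : u < n - 2 -> bswap 1 u = u by move=> lt_u; eval_bswap 1 u u.
have fix_gt u : n + 1 < u -> bswap 1 u = u by move=> lt_u; eval_bswap 1 u u.
have left_triple w : n + 1 < w -> w < 2 * n -> Y w < Y (n + 1) -> has_triple (Y \o bswap 1).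
  move=> gt_w lt_w ltY; exists (n - 1), n, w; rewrite /triple /= (fix_gt w) //.
  by eval_bswap 1 (n - 1) (n - 2); eval_bswap 1 n (n + 1); split; lia.
have right_triple w : w < n - 2 -> Y (n - 2) < Y w -> has_triple (Y \o bswap 1).
  move=> lt_w ltY; exists w, (n - 1), n; rewrite /triple /= (fix_lt w) //.
  by eval_bswap 1 (n - 1) (n - 2); eval_bswap 1 n (n + 1); split; lia.
have [e1|ne1] := boolP ((a == n) && (b == n + 1)).
  by case/andP: e1 => /eqP ea /eqP eb; rewrite ea eb in gtY; apply: (left_triple c); lia.
have [e2|ne2] := boolP ((b == n) && (c == n + 1)).
  case/andP: e2 => /eqP eb /eqP ec; rewrite eb ec in gtY.
  case: (a =P n - 1) => [ea|na1]; first by rewrite ea in gtY; lia.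
  case: (a =P n - 2) => [ea|na2]; first by rewrite ea in gtY; lia.
  by apply: (right_triple a); lia.
have [e3|ne3] := boolP ((a == n - 2) && (b == n - 1)).
  case/andP: e3 => /eqP ea /eqP eb; rewrite ea eb in gtY.
  case: (c =P n) => [ec|nc]; first by rewrite ec in gtY; lia.
  case: (c =P n + 1) => [ec|nc1]; first by rewrite ec in gtY; lia.
  by apply: (left_triple c); lia.
have [e4|ne4] := boolP ((b == n - 2) && (c == n - 1)).
  by case/andP: e4 => /eqP eb /eqP ec; rewrite eb ec in gtY; apply: (right_triple a); lia.
rewrite -(@position_genE 1) //; apply: (triple_swap _ tri); first by lia.
- by clear ne2 ne3 ne4; lia.
- by clear ne1 ne3 ne4; lia.
- by clear ne1 ne2 ne4; lia.
- by clear ne1 ne2 ne3; lia.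
Qed.

(** When the product of the two generators has order 3, three alternating descents force [j] to be a
    descent of [X]. When it has order 4 and [j] is an ascent, the values at the middle positions
    meet the hypotheses of [triple_swap1] or [triple_swap0]. *)
Lemma adjacent_descents X i j : i < n -> j < n -> adjacent i j -> signed X ->
  desc X i -> desc (X \o bswap i) j -> desc (X \o bswap i \o bswap j) i ->
  has_triple (X \o bswap i) -> desc X j \/ has_triple (X \o bswap i \o bswap j).
Proof.
move=> lt_in lt_jn adj X_signed d1 d2 d3 tri; have Y_signed := signed_bswap lt_in X_signed.
have [dj|ndj] := boolP (desc X j); [by left | right].
have [[X_opp X_inj] [Y_opp _]] := (X_signed, Y_signed).
case/orP: adj => /eqP e; move: d1 d2 d3 ndj; rewrite /desc /=.
  case: i => [|i] in e lt_in Y_signed Y_opp tri *; rewrite -{}e in lt_jn *.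
    rewrite addn0 addnK => d1 d2.
    eval_bswap 1 n (n + 1); eval_bswap 1 (n - 1) (n - 2) => d3.
    have lt_n1 : n + 1 < 2 * n by lia.
    have := Y_opp _ lt_n1; rewrite (_ : 2 * n - 1 - (n + 1) = n - 2) /=; last by lia.
    move=> opp; rewrite -leqNgt leq_eqVlt => /orP[/eqP /X_inj|lt_X]; first by lia.
    apply: triple_swap1 => //=; first by lia.
    by eval_bswap 0 (n - 1) n; eval_bswap 0 (n + 1) (n + 1).
  eval_bswap i.+1 (n + i.+2) (n + i.+2); eval_bswap i.+1 (n + i.+2 - 1) (n + i.+1 - 1).
  eval_bswap i.+2 (n + i.+1) (n + i.+2); eval_bswap i.+2 (n + i.+1 - 1) (n + i.+1 - 1).
  eval_bswap i.+1 (n + i.+2) (n + i.+2); eval_bswap i.+1 (n + i.+1 - 1) (n + i.+1).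
  by rewrite (_ : n + i.+2 - 1 = n + i.+1); lia.
case: j => [|j] in e lt_jn *; rewrite -{}e in lt_in Y_signed Y_opp tri *.
  rewrite addn0 addnK => d1 d2.
  eval_bswap 0 n (n - 1); eval_bswap 0 (n + 1) (n + 1) => d3.
  have lt_n : n < 2 * n by lia.
  have := X_opp _ lt_n; rewrite (_ : 2 * n - 1 - n = n - 1); last by lia.
  by move=> opp ndj; apply: triple_swap0 => //=; eval_bswap 1 (n + 1) n; lia.
eval_bswap j.+2 (n + j.+1) (n + j.+2); eval_bswap j.+2 (n + j.+1 - 1) (n + j.+1 - 1).
eval_bswap j.+1 (n + j.+2) (n + j.+2); eval_bswap j.+1 (n + j.+2 - 1) (n + j.+1 - 1).
eval_bswap j.+2 (n + j.+2) (n + j.+2 - 1); eval_bswap j.+2 (n + j.+1 - 1) (n + j.+1 - 1).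
by rewrite (_ : n + j.+2 - 1 = n + j.+1); lia.
Qed.

(** The position map of an alternating product of [k] generators; exchange [i] is applied first. *)
Fixpoint braid i j k p : nat := if k is k'.+1 then braid j i k' (bswap i p) else p.

(** A word starting with [j] and shorter than the braid relation cannot produce a descent at [i]; at
    most three exchanges have to be evaluated. *)
Lemma braid_ascent X i j k : i < n -> j < n -> i != j ->
  k < (if adjacent i j then if minn i j == 0 then 4 else 3 else 2) -> signed X ->
  ~~ desc X i -> ~~ desc X j -> ~~ desc (X \o braid j i k) i.
Proof.
move=> lt_in lt_jn /eqP ne_ij lt_k [X_opp _]; rewrite /desc /= -!leqNgt => asc_i asc_j.
have [adj|/norP[/eqP n1 /eqP n2]] := boolP (adjacent i j); last first.
  rewrite /adjacent (introF eqP n1) (introF eqP n2) /= in lt_k.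
  case: k => [|[|//]] in lt_k *; rewrite //=.
  by eval_bswap j (n + i) (n + i); eval_bswap j (n + i - 1) (n + i - 1).
rewrite adj in lt_k.
have lt_n : n < 2 * n by lia.
have := X_opp _ lt_n; rewrite (_ : 2 * n - 1 - n = n - 1) /=; last by lia.
move=> opp0; case/orP: adj => /eqP e.
  case: i => [|i] in e lt_in lt_k asc_i ne_ij *; rewrite -{}e in lt_jn asc_j lt_k *; clear ne_ij.
    have lt_n1 : n + 1 < 2 * n by lia.
    have := X_opp _ lt_n1; rewrite (_ : 2 * n - 1 - (n + 1) = n - 2) /= => [opp1|]; last by lia.
    rewrite !addn0 addnK in asc_i asc_j *; move: lt_k.
    case: k => [|[|[|[|//]]]] //= _; eval_bswap 1 n (n + 1); eval_bswap 1 (n - 1) (n - 2).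
    - by lia.
    - by eval_bswap 0 (n + 1) (n + 1); eval_bswap 0 (n - 2) (n - 2); lia.
    eval_bswap 0 (n + 1) (n + 1); eval_bswap 0 (n - 2) (n - 2).
    by eval_bswap 1 (n + 1) n; eval_bswap 1 (n - 2) (n - 1).
  rewrite (_ : n + i.+2 - 1 = n + i.+1) in asc_j; last by lia.
  move: lt_k; case: k => [|[|[|k]]] //=; last by case: ifP; lia.
    by eval_bswap i.+2 (n + i.+1) (n + i.+2); eval_bswap i.+2 (n + i.+1 - 1) (n + i.+1 - 1); lia.
  eval_bswap i.+2 (n + i.+1) (n + i.+2); eval_bswap i.+2 (n + i.+1 - 1) (n + i.+1 - 1).
  by eval_bswap i.+1 (n + i.+2) (n + i.+2); eval_bswap i.+1 (n + i.+1 - 1) (n + i.+1).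
case: j => [|j] in e lt_jn lt_k asc_j ne_ij *; rewrite -{}e in lt_in asc_i lt_k *; clear ne_ij.
  have lt_n1 : n + 1 < 2 * n by lia.
  have := X_opp _ lt_n1; rewrite (_ : 2 * n - 1 - (n + 1) = n - 2) /= => [opp1|]; last by lia.
  rewrite !addn0 addnK in asc_i asc_j *; move: lt_k.
  case: k => [|[|[|[|//]]]] //= _; eval_bswap 0 n (n - 1); eval_bswap 0 (n + 1) (n + 1).
  - by lia.
  - by eval_bswap 1 (n + 1) n; eval_bswap 1 (n - 1) (n - 2); lia.
  eval_bswap 1 (n + 1) n; eval_bswap 1 (n - 1) (n - 2).
  by eval_bswap 0 n (n - 1); eval_bswap 0 (n - 2) (n - 2); lia.
rewrite (_ : n + j.+2 - 1 = n + j.+1) in asc_i *; last by lia.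
move: lt_k; case: k => [|[|[|k]]] //=; last by case: ifP; lia.
  by eval_bswap j.+1 (n + j.+2) (n + j.+2); eval_bswap j.+1 (n + j.+1) (n + j.+1 - 1); lia.
eval_bswap j.+1 (n + j.+2) (n + j.+2); eval_bswap j.+1 (n + j.+1) (n + j.+1 - 1).
by eval_bswap j.+2 (n + j.+2) (n + j.+1); eval_bswap j.+2 (n + j.+1 - 1) (n + j.+1 - 1).
Qed.

End Descents.

(** * Left descents and fully commutative elements *)

Section Length.

Local Open Scope group_scope.

Variables (n : nat) (W : coxeter_system (@mB n)).
Implicit Types (w x y : W) (i j : 'I_n).

Local Notation s := (gen W).

Lemma ell_prod_le (e : seq 'I_n) : (ell (\prod_(i <- e) s i) <= size e)%N.
Proof.
rewrite /ell; case: ex_minnP => k _; apply.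
by apply/existsP; exists (in_tuple e).
Qed.

Lemma ell_word w : exists2 e : seq 'I_n, size e = ell w & w = \prod_(i <- e) s i.
Proof.
rewrite /ell; case: ex_minnP => k /existsP[e /eqP <-] _.
by exists e; rewrite ?size_tuple.
Qed.

Lemma ell1 : ell (1 : W) = 0%N.
Proof. by have := ell_prod_le [::]; rewrite big_nil leqn0 => /eqP. Qed.

Lemma ellM w x : (ell (w * x) <= ell w + ell x)%N.
Proof.
have [e <- ->] := ell_word w; have [f <- ->] := ell_word x.
by rewrite -big_cat /= -size_cat ell_prod_le.
Qed.

Lemma ell_gen i : (ell (s i) <= 1)%N.
Proof. by have := ell_prod_le [:: i]; rewrite big_seq1. Qed.

Lemma ell_gen_mul i w : (ell (s i * w) <= (ell w).+1)%N.
Proof. by apply: leq_trans (ellM _ _) _; rewrite -add1n leq_add2r ell_gen. Qed.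

Lemma genK i : s i * s i = 1.
Proof. by have := gen_rel W i i; rewrite /mB eqxx expg1. Qed.

Lemma genV i : (s i)^-1 = s i.
Proof. by apply/eqP; rewrite eq_invg_mul genK. Qed.

Lemma genKl i w : s i * (s i * w) = w.
Proof. by rewrite mulgA genK mul1g. Qed.

Lemma ellV w : ell w^-1 = ell w.
Proof.
suff le_ellV x : (ell x^-1 <= ell x)%N.
  by apply/eqP; rewrite eqn_leq le_ellV -{1}[w]invgK le_ellV.
have [e <- ->] := ell_word x.
have -> : (\prod_(i <- e) s i)^-1 = \prod_(i <- rev e) s i.
  elim: e => [|i e IHe]; first by rewrite !big_nil invg1.
  by rewrite big_cons rev_cons -cats1 big_cat big_seq1 invMg genV IHe.
by rewrite -(size_rev e) ell_prod_le.
Qed.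

Lemma gen_ind (P : W -> Prop) :
  P 1 -> (forall i w, P w -> P (s i * w)) -> forall w, P w.
Proof.
move=> P1 Ps w; have [e _ ->] := ell_word w.
by elim: e => [|i e IHe]; rewrite ?big_nil // big_cons; apply: Ps.
Qed.

(** The universal property yields a sign homomorphism, sending every generator to a transposition,
    which records the parity of [ell]. *)
Lemma ell_gen_mul_neq i w : ell (s i * w) <> ell w.
Proof.
have tK : tperm true false * tperm true false = 1 by rewrite tperm2.
have [] := gen_univ W (K := {perm bool}) (t := fun=> tperm true false).
  by move=> j k; rewrite tK expg1n.
move=> f fM fs; have f1 : f 1 = 1 by apply: (mulgI (f 1)); rewrite -fM !mulg1.
have f_prod e : f (\prod_(j <- e) s j) = tperm true false ^+ odd (size e).
  elim: e => [|j e IHe]; first by rewrite big_nil f1.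
  by rewrite big_cons fM fs IHe /=; case: odd; rewrite ?mulg1 ?tK.
have f_ell x : f x = tperm true false ^+ odd (ell x).
  by have [e {1}<- {1}->] := ell_word x.
move=> eq_ell; have := fM (s i) w; rewrite fs !f_ell eq_ell.
move=> /(congr1 (fun t : {perm bool} => t * (tperm true false ^+ odd (ell w))^-1)).
rewrite -mulgA mulgV mulg1 => /(congr1 (fun t : {perm bool} => t true)).
by rewrite perm1 tpermL.
Qed.

Definition ldesc w i := (ell (s i * w) < ell w)%N.

Lemma ldesc_ell w i : ldesc w i -> ell w = (ell (s i * w)).+1.
Proof.
have := ellM (s i) (s i * w); rewrite genKl; have := ell_gen i; rewrite /ldesc; lia.
Qed.

Lemma lasc_ell w i : ~~ ldesc w i -> ell (s i * w) = (ell w).+1.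
Proof.
have := ellM (s i) w; have := ell_gen i; have := @ell_gen_mul_neq i w; rewrite /ldesc; lia.
Qed.

Lemma ldesc_gen w i : ldesc (s i * w) i = ~~ ldesc w i.
Proof.
rewrite /ldesc genKl -leqNgt ltn_neqAle; case: eqP => // /esym/ell_gen_mul_neq //.
Qed.

Lemma ldesc_exists w : w != 1 -> exists i, ldesc w i.
Proof.
have [e] := ell_word w; case: e => [|i e] e_ell wE; first by rewrite wE big_nil eqxx.
move=> _; exists i; rewrite /ldesc -e_ell wE big_cons genKl.
exact: leq_ltn_trans (ell_prod_le e) _.
Qed.

Fixpoint alt i j k : W := if k is k'.+1 then s i * alt j i k' else 1.

Lemma ell_alt i j k : (ell (alt i j k) <= k)%N.
Proof.
elim: k i j => [|k IHk] i j /=; first by rewrite ell1.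
apply: leq_trans (ellM _ _) _; exact: leq_add (ell_gen i) (IHk j i).
Qed.

Lemma altD i j k l : alt i j (k + l) = alt i j k * (if odd k then alt j i l else alt i j l).
Proof.
elim: k i j => [|k IHk] i j /=; first by rewrite mul1g.
by rewrite IHk mulgA; case: odd.
Qed.

Lemma altSr i j k : alt i j k.+1 = alt i j k * s (if odd k then j else i).
Proof. by rewrite -addn1 altD; case: odd; rewrite /= mulg1. Qed.

Lemma altV i j k : (alt i j k)^-1 = if odd k then alt i j k else alt j i k.
Proof.
elim: k i j => [|k IHk] i j; first exact: invg1.
have -> : (alt i j k.+1)^-1 = (s i * alt j i k)^-1 by [].
by rewrite invMg genV IHk !altSr oddS; case: (odd k).
Qed.

Lemma alt_coxeter i j : alt i j (mB i j) = alt j i (mB i j).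
Proof.
have altX k : (s i * s j) ^+ k = alt i j (k + k).
  elim: k => [|k IHk] //; rewrite expgS IHk addSn addnS /= !mulgA //.
have := altX (mB i j); rewrite gen_rel altD => /eqP; rewrite eq_sym -eq_invg_mul => /eqP.
by rewrite altV; case: odd => // <-.
Qed.

(** Letters are peeled off alternately as long as the rest has [i] or [j] as a left descent; the
    letter just removed cannot recur, because the factorization is reduced. *)
Lemma alt_decomposition i j w : ldesc w j ->
  exists k y, [/\ (0 < k)%N, w = alt j i k * y, ell w = (k + ell y)%N, ~~ ldesc y i & ~~ ldesc y j].
Proof.
move=> dj; suff alt_dec m k y : (ell y < m)%N -> (0 < k)%N -> w = alt j i k * y ->
    ell w = (k + ell y)%N -> exists k y, [/\ (0 < k)%N, w = alt j i k * y,
      ell w = (k + ell y)%N, ~~ ldesc y i & ~~ ldesc y j].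
  by apply: (alt_dec _ 1%N (s j * w)) => //; rewrite /= ?mulg1 ?genKl // (ldesc_ell dj).
elim: m k y => // m IHm k y lt_m k_gt0 wE ell_w.
have ndl : ~~ ldesc y (if odd k then j else i).
  apply/negP; case: k => // k in k_gt0 wE ell_w *.
  rewrite altSr -mulgA in wE; rewrite oddS if_neg => dl; have := ldesc_ell dl.
  have := ellM (alt j i k) (s (if odd k then i else j) * y).
  by rewrite -wE ell_w; have := ell_alt j i k; lia.
have [dl|ndl'] := boolP (ldesc y (if odd k then i else j)).
  have := ldesc_ell dl => ell_y.
  apply: (IHm k.+1 (s (if odd k then i else j) * y)) => //; try lia.
  by rewrite altSr -mulgA genKl.
by exists k, y; split=> //; move: ndl ndl'; case: odd.
Qed.

Definition bswap_ord i (p : 'I_(2 * n)) : 'I_(2 * n) :=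
  Ordinal (bswap_lt (ltn_ord i) (ltn_ord p)).

Lemma bswap_ord_inj i : injective (bswap_ord i).
Proof. by move=> p r /(congr1 val) /(inv_inj (bswapK (ltn_ord i))) /val_inj. Qed.

Lemma bswap_coxeter i j p :
  iter (mB i j) (fun r => bswap n j (bswap n i r)) p = p.
Proof.
rewrite /mB; case: (i =P j) => [->|]; first by rewrite /= bswapK.
case: i j => [i lti] [j ltj] /= ne_ij; have {}ne_ij : i <> j by move=> e; apply/ne_ij/val_inj.
have K k : (k < n)%N -> involutive (bswap n k) := @bswapK n k.
case: ifP => [/orP[]/eqP e|/norP[/eqP n1 /eqP n2]].
- rewrite -e in ltj *; rewrite (minn_idPl _) //; case: eqP => [->|/eqP] /=.
    by rewrite -bswap_braid4 ?K //; lia.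
  by rewrite -lt0n => i_gt0; rewrite -bswap_braid3 ?K.
- rewrite -e in lti *; rewrite (minn_idPr _) //; case: eqP => [->|/eqP] /=.
    by rewrite bswap_braid4 ?K //; lia.
  by rewrite -lt0n => j_gt0; rewrite bswap_braid3 ?K.
have [lt|lt|//] := ltngtP i j; rewrite /=.
  by rewrite [bswap n i (bswap n j _)]bswapC ?K //; lia.
by rewrite [bswap n j (bswap n i _)]bswapC ?K //; lia.
Qed.


(** The relations of [bswap_coxeter] give an action by the universal property; permutations compose
    from left to right, so left multiplication acts on positions. *)
Lemma position_action : exists X : W -> nat -> nat,
  X 1 =1 id /\ forall i w, X (s i * w) =1 X w \o bswap n i.
Proof.
pose t i := perm (@bswap_ord_inj i).
have [] := gen_univ W (t := t).
  move=> i j; apply/permP => p; rewrite perm1; apply: val_inj.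
  apply: etrans (bswap_coxeter i j p); elim: (mB i j) => [|k IHk]; first by rewrite perm1.
  by rewrite expgSr !permM /= !permE /= IHk.
move=> f fM fs; have f1 : f 1 = 1 by apply: (mulgI (f 1)); rewrite -fM !mulg1.
(* Numbers from [2 * n] on are fixed, as they are by [bswap], so the rule holds at every natural
   number. *)
exists (fun w p => if insub p is Some o then f w o : nat else p); split=> [p | i w p] /=.
  by case: insubP => //= o _ <-; rewrite f1 perm1.
case: insubP => [o _ <- | out_p].
  rewrite fM fs permM permE insubT ?(valP (bswap_ord i o)) // => lt_p.
  by congr (val (f w _)); apply: val_inj.
have -> : bswap n i p = p by have := bswapE p (ltn_ord i); have := ltn_ord i; lia.
by rewrite insubN.
Qed.

End Length.

(** * Left descents in one-line notation *)

Section Action.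

Local Open Scope group_scope.

Variables (n : nat) (W : coxeter_system (@mB n)) (X : W -> nat -> nat).
Hypotheses (X1 : X 1 =1 id) (Xs : forall i w, X (gen W i * w) =1 X w \o bswap n i).
Implicit Types (w x y : W) (i j : 'I_n).

Local Notation s := (gen W).

Lemma action_signed w : signed n (X w).
Proof.
elim/gen_ind: w => [|i w IHw].
  by split=> [p lt_p | p r _ _]; rewrite !X1 /=; lia.
have [opp inj] := signed_bswap (ltn_ord i) IHw.
by split=> [p | p r]; rewrite !Xs; [exact: opp | exact: inj].
Qed.

Lemma desc_gen i j w : desc n (X (s i * w)) j = desc n (X w \o bswap n i) j.
Proof. by rewrite /desc !Xs. Qed.

Lemma desc_genK i w : desc n (X (s i * w)) i = ~~ desc n (X w) i.
Proof.
have [_ X_inj] := action_signed w; have lti := ltn_ord i.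
rewrite desc_gen /desc /= -leqNgt [RHS]leq_eqVlt.
eval_bswap_in n i (n + i)%N (n + i - 1)%N.
eval_bswap_in n i (n + i - 1)%N (n + i)%N.
by case: eqP => [/X_inj|//]; lia.
Qed.

Lemma X_alt i j k w : X (alt W i j k * w) =1 X w \o braid n i j k.
Proof.
elim: k i j => [|k IHk] i j p /=; first by rewrite mul1g.
by rewrite -mulgA Xs /= IHk.
Qed.

(* Write w = u y with u the longest possible alternating word in s_j and s_i; then y
   ascends at both i and j, and u is too short to create a descent at i. *)
Lemma ascent_of_lasc i w : ~~ ldesc w i -> ~~ desc n (X w) i.
Proof.
have [k] := ubnP (ell w); elim: k i w => // k IHk i w lt_k ai.
have [->|] := eqVneq w 1.
  by rewrite /desc !X1 /=; have := ltn_ord i; lia.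
case/ldesc_exists => j dj; have ne_ij : i != j by apply: contraNneq ai => ->.
have [m [y [m_gt0 wE ell_w yi yj]]] := alt_decomposition i dj.
have desc_y := IHk _ y; rewrite wE /desc !X_alt.
have [lt_m|le_m] := ltnP m (mB i j).
  apply: braid_ascent => //; try exact: action_signed; try by apply: desc_y => //; lia.
  by move: lt_m; rewrite /mB (negbTE ne_ij).
(* A prefix of length at least [mB i j] can be rewritten to begin with [s i], which makes [i] a left
   descent. *)
case/negP: ai; rewrite /ldesc ell_w wE -(subnKC le_m) altD -mulgA -alt_coxeter.
have [l mE] : exists l, mB i j = l.+1.
  by exists (mB i j).-1; rewrite /mB; do 2!case: ifP => // _; case: ifP.
rewrite mE /= -!mulgA genKl.
have le_rest a b : (ell (alt W a b (m - l.+1) * y) <= m - l.+1 + ell y)%N.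
  exact: leq_trans (ellM _ _) (leq_add (ell_alt _ _ _ _) _).
rewrite mE in le_m; apply: leq_ltn_trans (ellM _ _) _.
by case: (~~ odd l); apply: leq_ltn_trans (leq_add (ell_alt W j i l) (le_rest _ _)) _; lia.
Qed.

(** One implication is the contrapositive of [ascent_of_lasc]; the other applies it to [s i * w],
    where [i] is an ascent. *)
Lemma ldesc_desc i w : ldesc w i = desc n (X w) i.
Proof.
apply/idP/idP => [di|]; last by apply: contraLR; exact: ascent_of_lasc.
by apply/negPn; rewrite -desc_genK ascent_of_lasc // ldesc_gen negbK.
Qed.

Lemma mB_sym i j : mB i j = mB j i.
Proof. by rewrite /mB eq_sym orbC minnC. Qed.

Lemma mB_gt0 i j : (0 < mB i j)%N.
Proof. by rewrite /mB; do 2!case: ifP => // _; case: ifP. Qed.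

Lemma noncommuting_adjacent i j : noncommuting W i j = adjacent i j.
Proof.
apply/idP/idP => [|adj].
  apply: contraR => nadj; case: (eqVneq i j) => [-> //|ne_ij].
  have := alt_coxeter W i j; rewrite /mB (negbTE ne_ij) -/(adjacent i j) (negbTE nadj).
  by rewrite /= !mulg1 => ->.
wlog ij : i j adj / i.+1 = j :> nat => [wlog_ij|].
  case/orP: (adj) => /eqP e; first exact: wlog_ij.
  by rewrite /noncommuting eq_sym; apply: wlog_ij; rewrite // /adjacent orbC.
(* The two products send the position [n + i - 1] to different places. *)
apply/eqP => /(congr1 (fun w => X (w * 1) (n + i - 1)%N)).
have [lti ltj] := (ltn_ord i, ltn_ord j); rewrite -!mulgA !Xs /= !Xs /= !X1 /= -ij.
eval_bswap_in n i (n + i - 1)%N (n + i)%N.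
eval_bswap_in n i.+1 (n + i)%N (n + i.+1)%N.
case: (posnP i) => [->|i_gt0].
  eval_bswap_in n 1%N (n + 0 - 1)%N (n - 2)%N.
  by rewrite (_ : bswap n 0 (n - 2) = n - 2); [lia | rewrite /bswap; decide_ifs; lia].
eval_bswap_in n i.+1 (n + i - 1)%N (n + i - 1)%N.
by rewrite (_ : bswap n i (n + i - 1) = n + i)%N; [lia | rewrite /bswap; decide_ifs; lia].
Qed.

Lemma alt_lasc i j k y : i != j -> (k < mB i j)%N -> ~~ ldesc y i -> ~~ ldesc y j ->
  ~~ ldesc (alt W j i k * y) i.
Proof.
move=> ne_ij lt_k; rewrite !ldesc_desc => yi yj; rewrite /desc !X_alt.
apply: braid_ascent => //; last exact: action_signed.
by move: lt_k; rewrite /mB (negbTE ne_ij).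
Qed.

Lemma ell_alt_mul i j k y : i != j -> (k <= mB i j)%N -> ~~ ldesc y i -> ~~ ldesc y j ->
  ell (alt W i j k * y) = (k + ell y)%N.
Proof.
elim: k i j => [|k IHk] i j ne_ij le_k yi yj; first by rewrite mul1g.
by rewrite /= -mulgA lasc_ell ?alt_lasc // IHk // 1?eq_sym // mB_sym ltnW.
Qed.

(** The alternating prefix has length at least [mB i j], for otherwise [i] would be an ascent. The
    word of length [mB i j] can be made to end in either letter, so neither is a left descent of the
    remaining factor. *)
Lemma ldesc2_alt i j w : i != j -> ldesc w i -> ldesc w j ->
  exists y, [/\ w = alt W i j (mB i j) * y, ell w = (mB i j + ell y)%N,
                ~~ ldesc y i & ~~ ldesc y j].
Proof.
move=> ne_ij di dj; have [k [y [k_gt0 wE ell_w yi yj]]] := alt_decomposition i dj.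
have le_k : (mB i j <= k)%N.
  by rewrite leqNgt; apply: contraL di => lt_k; rewrite wE alt_lasc.
set y' := (if odd (mB i j) then alt W i j (k - mB i j) else alt W j i (k - mB i j)) * y.
have wE' : w = alt W i j (mB i j) * y' by rewrite alt_coxeter /y' mulgA -altD subnKC.
have le_y' : (ell y' <= k - mB i j + ell y)%N.
  by apply: leq_trans (ellM _ _) (leq_add _ (leqnn _)); case: odd; exact: ell_alt.
have lasc_y' l : (exists a b, alt W i j (mB i j) = alt W a b (mB i j).-1 * s l) -> ~~ ldesc y' l.
  case=> a [b altE]; apply/negP => /ldesc_ell ell_y'.
  have := ellM (alt W a b (mB i j).-1) (s l * y'); rewrite mulgA -altE -wE'.
  by have := ell_alt W a b (mB i j).-1; have := mB_gt0 i j; lia.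
have altE : alt W i j (mB i j) = alt W i j (mB i j).-1 * s (if odd (mB i j).-1 then j else i).
  by rewrite -altSr prednK ?mB_gt0.
have altE' : alt W i j (mB i j) = alt W j i (mB i j).-1 * s (if odd (mB i j).-1 then i else j).
  by rewrite -altSr prednK ?mB_gt0 // alt_coxeter.
exists y'; split=> //.
- have := ellM (alt W i j (mB i j)) y'; rewrite -wE'.
  by have := ell_alt W i j (mB i j); lia.
- apply: lasc_y'; case: (odd _) altE altE' => altE altE'; by [exists j, i | exists i, j].
by apply: lasc_y'; case: (odd _) altE altE' => altE altE'; [exists i, j | exists j, i].
Qed.

Lemma parabolic2_alt i j u : u \in parabolic2 W i j ->
  exists2 k, (k <= mB i j)%N & u = alt W i j k \/ u = alt W j i k.
Proof.
case/gen_prodgP=> r [t tP ->]; rewrite -(big_map t xpredT id) /=.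
have : all (fun x => x \in [set s i; s j]) [seq t k | k <- index_enum 'I_r].
  by apply/allP => _ /mapP[k _ ->]; exact: tP.
elim: map => [|x e IHe] /=; first by exists 0%N; rewrite ?big_nil //; left.
rewrite big_cons => /andP[/set2P xP] /IHe [k le_k eE].
have step a b : mB a b = mB i j ->
    \prod_(z <- e) z = alt W a b k \/ \prod_(z <- e) z = alt W b a k ->
  exists2 k', (k' <= mB i j)%N &
    s a * \prod_(z <- e) z = alt W a b k' \/ s a * \prod_(z <- e) z = alt W b a k'.
  move=> mE; have [->|k_gt0] := posnP k.
    by case=> ->; exists 1%N; rewrite ?mB_gt0 //; left.
  have cancel_a : s a * alt W a b k = alt W b a k.-1 by rewrite -(prednK k_gt0) /= genKl.
  case=> ->; first by exists k.-1; [lia | right].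
  have [lt_k|ge_k] := ltnP k (mB i j); first by exists k.+1 => //; left.
  exists k.-1; first by lia.
  by right; rewrite (_ : alt W b a k = alt W a b k) // (_ : k = mB a b) ?alt_coxeter //; lia.
case: xP => ->; first exact: (step i j).
have [|k' le_k' [kE|kE]] := step j i (mB_sym j i); first by case: eE; [right | left].
  by exists k' => //; right.
by exists k' => //; left.
Qed.

Lemma alt_parabolic2 i j k : alt W i j k \in parabolic2 W i j.
Proof.
have alt_in a b : alt W a b k \in <<[set s a; s b]>>.
  elim: k a b => [|m IHm] a b /=; first exact: group1.
  by apply: groupM; [rewrite mem_gen ?set21 | rewrite setUC; exact: IHm].
exact: alt_in.
Qed.

Lemma longest_altP i j : i != j -> longest (parabolic2 W i j) (alt W i j (mB i j)).
Proof.
move=> ne_ij; rewrite /longest alt_parabolic2; apply/forall_inP => u /parabolic2_alt[k le_k uE].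
rewrite -[alt W i j _]mulg1 ell_alt_mul ?ell1 ?addn0 /ldesc ?ell1 //.
by apply: leq_trans le_k; case: uE => ->; exact: ell_alt.
Qed.

Lemma adjacent_neq i j : adjacent i j -> i != j.
Proof. by apply: contraTneq => ->; rewrite /adjacent gtn_eqF. Qed.

Lemma has_triple_ext (Y Z : nat -> nat) : Y =1 Z -> has_triple n Y -> has_triple n Z.
Proof.
by move=> eqYZ [a [b [c tri]]]; exists a, b, c; move: tri; rewrite /triple !eqYZ.
Qed.

(** The factor [u * x2] descends at [i] and [j], hence has a triple; each letter of [x1] raises the
    length, so [ascent_triple] carries the triple to [w]. *)
Lemma not_fc_triple w : ~~ fully_commutative w -> has_triple n (X w).
Proof.
rewrite /fully_commutative negbK.
case/existsP=> i /existsP[j /existsP[x1 /existsP[u /existsP[x2]]]].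
case/and4P=> nc /andP[uP /forall_inP u_max] /eqP wE /eqP ell_w.
have adj : adjacent i j by rewrite -noncommuting_adjacent.
have ell_ux2 : (ell u + ell x2 <= ell (u * x2))%N.
  by have := ellM x1 (u * x2); rewrite mulgA -wE ell_w; lia.
have desc_ux2 l : s l \in parabolic2 W i j -> desc n (X (u * x2)) l.
  move=> lP; rewrite -ldesc_desc /ldesc mulgA; apply: leq_trans ell_ux2.
  apply: leq_ltn_trans (ellM _ _) _; rewrite ltn_add2r ltn_neqAle u_max ?groupM //.
  by rewrite andbT; apply/eqP/ell_gen_mul_neq.
have di := desc_ux2 i (mem_gen (set21 _ _)); have dj := desc_ux2 j (mem_gen (set22 _ _)).
have tri : has_triple n (X (u * x2)).
  by case/orP: adj => /eqP ij; [apply: (@desc_triple _ _ i) | apply: (@desc_triple _ _ j)];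
    rewrite ?ij.
have [e e_size x1E] := ell_word x1.
have : ell (\prod_(l <- e) s l * (u * x2)) = (size e + ell (u * x2))%N.
  apply/eqP; rewrite eqn_leq e_size -x1E mulgA -wE ell_w -addnA leq_add2l ell_ux2.
  by rewrite leq_add2l ellM.
rewrite wE -mulgA x1E; elim: e {e_size x1E} => [|l e IHe]; first by rewrite big_nil mul1g.
rewrite big_cons -mulgA => ell_le.
have ell_eq : ell (\prod_(l <- e) s l * (u * x2)) = (size e + ell (u * x2))%N.
  apply/eqP; rewrite eqn_leq (leq_trans (ellM _ _)) ?leq_add2r ?ell_prod_le //=.
  by rewrite -ltnS -addSn -[(size e).+1]/(size (l :: e)) -ell_le ell_gen_mul.
have {}IHe := IHe ell_eq; apply: has_triple_ext (fun p => esym (Xs _ _ p)) _.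
apply: ascent_triple => //; first exact: action_signed.
by rewrite -ldesc_desc /ldesc ell_le ell_eq /=; lia.
Qed.

(** Induction on length through [triple_descents]: adjacent descents split off a longest element on
    the left; otherwise a factorization of [s l * w] extends to [w]. *)
Lemma triple_not_fc w : has_triple n (X w) -> ~~ fully_commutative w.
Proof.
have [k] := ubnP (ell w); elim: k w => // k IHk w lt_k tri.
have both_descents i j : adjacent i j -> ldesc w i -> ldesc w j -> ~~ fully_commutative w.
  move=> adj di dj; have ne_ij := adjacent_neq adj.
  have [y [wE ell_w yi yj]] := ldesc2_alt ne_ij di dj.
  rewrite /fully_commutative negbK; apply/existsP; exists i; apply/existsP; exists j.
  apply/existsP; exists 1; apply/existsP; exists (alt W i j (mB i j)); apply/existsP; exists y.
  rewrite noncommuting_adjacent adj longest_altP // mul1g -wE eqxx /= ell1 add0n ell_w.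
  by rewrite -[alt _ _ _ _]mulg1 ell_alt_mul ?ell1 ?addn0 /ldesc ?ell1.
case: (triple_descents (action_signed w) tri) => [[i [lt_in d1 d2]]|].
  apply: (both_descents (Ordinal (ltnW lt_in)) (Ordinal lt_in)); rewrite ?ldesc_desc //.
  by rewrite /adjacent eqxx.
case=> i [j [[lt_in lt_jn] adj di tri' dj]]; pose l := Ordinal lt_in.
have dl : ldesc w l by rewrite ldesc_desc.
have : ~~ fully_commutative (s l * w).
  apply: IHk; first by rewrite (ldesc_ell dl) in lt_k.
  by apply: has_triple_ext tri' => p; rewrite Xs.
rewrite {1}/fully_commutative.
move=> /negPn/existsP[a /existsP[b /existsP[x1 /existsP[u /existsP[x2]]]]].
case/and4P=> nc lng /eqP wE /eqP ell_w.
apply/negPn/existsP; exists a; apply/existsP; exists b; apply/existsP; exists (s l * x1).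
apply/existsP; exists u; apply/existsP; exists x2.
rewrite nc lng -!mulgA !(mulgA x1) -wE genKl eqxx /=.
have := ldesc_ell dl; have := ellM (s l) x1; have := ell_gen W l.
have := ellM (s l * x1 * u) x2; have := ellM (s l * x1) u.
by rewrite -!mulgA !(mulgA x1) -wE genKl; lia.
Qed.

Lemma not_fcP w : reflect (has_triple n (X w)) (w \notin Wc W).
Proof. by rewrite inE; apply: (iffP idP); [exact: not_fc_triple | exact: triple_not_fc]. Qed.

Lemma not_fc_ldesc2 i j w : noncommuting W i j -> ldesc w i -> ldesc w j -> w \notin Wc W.
Proof.
rewrite noncommuting_adjacent !ldesc_desc => adj di dj; apply/not_fcP.
by case/orP: adj => /eqP ij; [apply: (@desc_triple _ _ i) | apply: (@desc_triple _ _ j)];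
  rewrite ?ij.
Qed.

(** The last clause serves the lattice estimate: if [s j * (s i * w)] is fully commutative, then [i]
    is not a left descent of it. *)
Lemma not_fc_reduction w : w \notin Wc W ->
  (exists i j, [/\ noncommuting W i j, ldesc w i & ldesc w j]) \/
  exists i j, [/\ noncommuting W i j, ldesc w i, s i * w \notin Wc W, ldesc (s i * w) j
    & ldesc (s j * (s i * w)) i -> s j * (s i * w) \notin Wc W].
Proof.
move/not_fcP => tri; case: (triple_descents (action_signed w) tri) => [[i [lt_in d1 d2]]|].
  left; exists (Ordinal (ltnW lt_in)), (Ordinal lt_in).
  by rewrite noncommuting_adjacent /adjacent eqxx !ldesc_desc.
case=> k [l [[lt_k lt_l] adj di tri' dj]]; pose i := Ordinal lt_k; pose j := Ordinal lt_l.
have nc : noncommuting W i j by rewrite noncommuting_adjacent.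
have Xss : X (s j * (s i * w)) =1 X w \o bswap n i \o bswap n j.
  by move=> p; rewrite !Xs /= Xs.
have [wj|nwj] := boolP (ldesc w j); [by left; exists i, j; rewrite ldesc_desc | right].
exists i, j; split=> //; first by rewrite ldesc_desc.
- by apply/not_fcP; apply: has_triple_ext tri' => p; rewrite Xs.
- by rewrite ldesc_desc desc_gen.
rewrite ldesc_desc /desc !Xss => di'; apply/not_fcP.
have [] := @adjacent_descents n (X w) i j lt_k lt_l adj (action_signed w) di dj di' tri'.
  by rewrite -ldesc_desc (negbTE nwj).
by apply: has_triple_ext => p; rewrite Xss.
Qed.

Lemma ldesc2_parabolic2 i j w : noncommuting W i j -> ldesc w i -> ldesc w j ->
  exists w0 y, [/\ w = w0 * y, w0 \in parabolic2 W i j,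
    {in parabolic2 W i j, forall u, ell (u * y) = (ell u + ell y)%N}
    & {in parabolic2 W i j, forall u, u != w0 -> (ell u < ell w0)%N}].
Proof.
rewrite noncommuting_adjacent => /adjacent_neq ne_ij di dj.
have [y [wE ell_w yi yj]] := ldesc2_alt ne_ij di dj.
have ell_alt_y a b k : (a, b) \in [:: (i, j); (j, i)] -> (k <= mB i j)%N ->
    forall z, ~~ ldesc z i -> ~~ ldesc z j -> ell (alt W a b k * z) = (k + ell z)%N.
  by rewrite !inE => /orP[]/eqP[-> ->] le_k z zi zj; rewrite ell_alt_mul // 1?eq_sym // mB_sym.
have ell_alt1 a b k : (a, b) \in [:: (i, j); (j, i)] -> (k <= mB i j)%N -> ell (alt W a b k) = k.
  by move=> ab le_k; rewrite -[alt _ _ _ _]mulg1 ell_alt_y ?ell1 ?addn0 /ldesc ?ell1.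
have ij : (i, j) \in [:: (i, j); (j, i)] by rewrite !inE eqxx.
have ji : (j, i) \in [:: (i, j); (j, i)] by rewrite !inE eqxx orbT.
exists (alt W i j (mB i j)), y; split=> //; first exact: alt_parabolic2.
  by move=> u /parabolic2_alt[k le_k [] ->]; rewrite ell_alt_y // ell_alt1.
move=> u /parabolic2_alt[k le_k uE] ne_u; rewrite (ell_alt1 i j) //.
have lt_k : (k < mB i j)%N.
  rewrite ltn_neqAle le_k andbT; apply: contraNneq ne_u => kE.
  by case: uE => ->; rewrite kE // alt_coxeter.
by case: uE => ->; rewrite ell_alt1.
Qed.

End Action.

(** * The lattice in the Temperley-Lieb quotient *)

Local Open Scope ring_scope.

(** * Degrees of Laurent polynomials *)

Section LaurentDegree.

Implicit Types (a b : laurent) (k l : int).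

(** [deg_le 0] is [in_Aneg], and [deg_le (-1)] describes v^-1 A^-. *)
Definition deg_le k a := forall l, k < l -> a@_l = 0.

Lemma deg_le0 k : deg_le k 0.
Proof. by move=> l _; rewrite mcoeff0. Qed.

Lemma deg_leD k a b : deg_le k a -> deg_le k b -> deg_le k (a + b).
Proof. by move=> da db l lt_l; rewrite mcoeffD da ?db. Qed.

Lemma deg_leN k a : deg_le k a -> deg_le k (- a).
Proof. by move=> da l lt_l; rewrite mcoeffN da ?oppr0. Qed.

Lemma deg_leB k a b : deg_le k a -> deg_le k b -> deg_le k (a - b).
Proof. by move=> da db; apply/deg_leD => //; exact: deg_leN. Qed.

Lemma deg_le_sum (I : finType) k (F : I -> laurent) :
  (forall i, deg_le k (F i)) -> deg_le k (\sum_i F i).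
Proof.
move=> dF; elim/big_rec: _ => [|i a _]; [exact: deg_le0 | exact: deg_leD].
Qed.

Lemma deg_le_trans k l a : k <= l -> deg_le k a -> deg_le l a.
Proof. by move=> le_kl da m lt_m; rewrite da // (le_lt_trans le_kl). Qed.

Lemma deg_leM k l a b : deg_le k a -> deg_le l b -> deg_le (k + l) (a * b).
Proof.
move=> da db m lt_m; rewrite -[a * b]/(lmul a b) /lmul raddf_sum /= big_seq big1 // => i a_i.
rewrite raddf_sum /= big_seq big1 // => j b_j; rewrite mcoeffU.
have le_i : i <= k by rewrite leNgt; apply: contraL a_i => /da e; rewrite -mcoeff_eq0 e.
have le_j : j <= l by rewrite leNgt; apply: contraL b_j => /db e; rewrite -mcoeff_eq0 e.
by case: eqP => // e; lia.
Qed.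

Lemma deg_le_vX k : deg_le k (vX k).
Proof. by move=> l lt_l; rewrite mcoeffU; case: eqP => // e; lia. Qed.

Lemma deg_le1 : deg_le 0 1.
Proof. exact: deg_le_vX. Qed.

Lemma vXK k a : vX (- k) * (vX k * a) = a.
Proof. by rewrite mulrA -vXD addNr mul1r. Qed.

Lemma deg_le_vXM k l a : deg_le l (vX k * a) -> deg_le (l - k) a.
Proof.
by move=> da; rewrite -(vXK k a) addrC; apply: deg_leM da; exact: deg_le_vX.
Qed.

Lemma deg_le_ex a : exists k, deg_le k a.
Proof.
exists (\sum_(i <- msupp a) `|i|) => l lt_l; apply/eqP; rewrite mcoeff_eq0.
apply/negP => a_l; move: lt_l; rewrite (big_fsetD1 l) //= ltNge => /negP[].
by apply: (le_trans (ler_norm _)); rewrite lerDl sumr_ge0.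
Qed.

Lemma deg_le_all a : (forall k, deg_le k a) -> a = 0.
Proof. by move=> da; apply/malgP => l; rewrite mcoeff0 (da (l - 1)) //; lia. Qed.

Lemma in_vAnegP a : in_vAneg a <-> deg_le (-1) a.
Proof.
split=> [[b db ->]|da]; first by rewrite -[- 1]addr0; apply: deg_leM db; exact: deg_le_vX.
exists (vX 1 * a); last by rewrite mulrA -vXD addNr mul1r.
have : deg_le (1 - 1) (vX 1 * a) by apply: deg_leM da; exact: deg_le_vX.
by rewrite subrr.
Qed.

Lemma deg_le_barA a : deg_le (-1) a -> barA a = a -> a = 0.
Proof.
move=> da bar_a; apply/malgP => k; rewrite mcoeff0.
have [lt_k|le_k] := ltP (-1) k; first exact: da.
by rewrite -bar_a barAE da //; lia.
Qed.

End LaurentDegree.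

(** * Expansions of the images of T~_w *)

Section Lattice.

Variables (n : nat) (W : coxeter_system (@mB n)) (H : hecke_algebra W).
Variable (TL : temperley_lieb H).
Implicit Types (w x y z : W) (i j : 'I_n)  (t : TL) (k l : int) (N : nat).

Local Notation s := (gen W).
Local Notation tt := (ttilde TL).

Lemma heckeT_mul u y : ell (u * y)%g = (ell u + ell y)%N ->
  heckeT H u * heckeT H y = heckeT H (u * y)%g.
Proof.
have [e] := ell_word u; elim: e u => [|i e IHe] u e_size uE.
  by rewrite uE big_nil mul1g hecke1 mul1r.
rewrite big_cons in uE; set u' := (\prod_(_ <- e) _)%g in uE.
rewrite uE -mulgA => ell_uy.
have ell_u : ell u = (ell u').+1.
  apply/eqP; rewrite eqn_leq {1}uE ell_gen_mul -e_size /= ltnS.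
  exact: ell_prod_le.
have size_e : size e = ell u' by apply/eqP; rewrite -eqSS -ell_u -e_size.
have ell_u'y : ell (u' * y)%g = (ell u' + ell y)%N.
  apply/eqP; rewrite eqn_leq ellM -ltnS -addSn -ell_u uE -ell_uy ell_gen_mul //.
have up1 : (ell u' < ell (s i * u')%g)%N by rewrite -uE ell_u.
have up2 : (ell (u' * y)%g < ell (s i * (u' * y))%g)%N by rewrite ell_uy ell_u'y -uE ell_u addSn.
by rewrite -(hecke_up H up1) -mulrA (IHe u') // (hecke_up H up2).
Qed.

Lemma theta_heckeT w : theta TL (heckeT H w) = vX (ell w)%:Z *: tt w.
Proof. by rewrite /ttilde scalerA -vXD subrr vX0 scale1r. Qed.

Lemma ell_gen1 i : ell (s i) = 1%N.
Proof.
have := @ell_gen_mul_neq _ W i 1%g; have := ell_gen W i; rewrite mulg1 ell1.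
by case: ell => [|[]].
Qed.

Lemma theta_lin a b (g h : H) : theta TL (a *: g + b *: h) = a *: theta TL g + b *: theta TL h.
Proof. by rewrite linearD !linearZ. Qed.

Lemma thetaM (g h : H) : theta TL (g * h) = theta TL g * theta TL h.
Proof. by rewrite rmorphM. Qed.

Lemma ttilde_up i w : ~~ ldesc w i -> tt (s i) * tt w = tt (s i * w)%g.
Proof.
move=> ai; rewrite /ttilde -scalerAl -scalerAr scalerA -thetaM.
rewrite hecke_up ?lasc_ell // ell_gen1 -vXD; congr (vX _ *: _); lia.
Qed.

Lemma ttilde_down i w : ldesc w i ->
  tt (s i) * tt w = tt (s i * w)%g + (vX 1 - vX (-1)) *: tt w.
Proof.
move=> di; rewrite /ttilde -scalerAl -scalerAr scalerA -thetaM hecke_down //.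
rewrite theta_lin scalerDr !scalerA ell_gen1 (ldesc_ell di).
rewrite scalerDr !scalerA (_ : q = vX 2); last by rewrite /q /v expr2 -vXD.
rewrite !mulrBr !mulr1 mulrBl -!vXD.
congr (vX _ *: _ + (vX _ - vX _) *: _); lia.
Qed.

(** Refines v^k L by a length bound [N], so that the induction hypothesis reaches every basis
    element that occurs, even after multiplication by a generator. *)
Definition lat k N t := exists a, [/\ forall z, deg_le k (a z),
  forall z, a z != 0 -> (z \in Wc W) && (ell z <= N)%N & t = \sum_z a z *: tt z].

Lemma lat0 k N : lat k N 0.
Proof.
exists (fun=> 0); split=> [z|z|]; rewrite ?eqxx //; first exact: deg_le0.
by rewrite big1 // => z _; rewrite scale0r.
Qed.

Lemma latD k N t t' : lat k N t -> lat k N t' -> lat k N (t + t').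
Proof.
move=> [a [da sa ->]] [b [db sb ->]]; exists (fun z => a z + b z).
split=> [z|z|]; first exact: deg_leD.
  have [a0|/sa //] := eqVneq (a z) 0; rewrite a0 add0r; exact: sb.
by rewrite -big_split; apply: eq_bigr => z _; rewrite scalerDl.
Qed.

Lemma latZ k l N b t : deg_le l b -> lat k N t -> lat (l + k) N (b *: t).
Proof.
move=> db [a [da sa ->]]; exists (fun z => b * a z); split=> [z|z|].
- exact: deg_leM.
- by move=> nz; apply: sa; apply: contraNneq nz => ->; rewrite mulr0.
- by rewrite scaler_sumr; apply: eq_bigr => z _; rewrite scalerA.
Qed.

Lemma latN k N t : lat k N t -> lat k N (- t).
Proof.
by move=> lt; rewrite -scaleN1r -[k]add0r; apply: latZ lt; apply/deg_leN/deg_le1.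
Qed.

Lemma lat_sum k N (I : finType) (P : pred I) (F : I -> TL) :
  (forall o, P o -> lat k N (F o)) -> lat k N (\sum_(o | P o) F o).
Proof. by move=> lF; elim/big_ind: _ => //; [exact: lat0 | exact: latD]. Qed.

Lemma lat_trans k l N M t : k <= l -> (N <= M)%N -> lat k N t -> lat l M t.
Proof.
move=> le_kl le_NM [a [da sa ->]]; exists a; split=> // [z|z /sa /andP[-> /=]].
  exact: deg_le_trans (da z).
by move/leq_trans; apply.
Qed.

Lemma ttilde_delta w : tt w = \sum_z (if z == w then 1 else 0) *: tt z.
Proof.
rewrite (bigD1 w) //= eqxx scale1r big1 ?addr0 // => z /negbTE->.
by rewrite scale0r.
Qed.

Lemma lat_ttilde w : w \in Wc W -> lat 0 (ell w) (tt w).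
Proof.
move=> wc; exists (fun z => if z == w then 1 else 0); split=> [z|z|].
- by case: ifP => _; [exact: deg_le1 | exact: deg_le0].
- by case: ifP => [/eqP->|_]; rewrite ?wc ?leqnn ?eqxx.
- by rewrite ttilde_delta.
Qed.

Section Independent.

(** Deduced from the canonical basis in [ttilde_free]. *)
Hypothesis tt_free : forall a : W -> laurent, (forall z, z \notin Wc W -> a z = 0) ->
  \sum_z a z *: tt z = 0 -> forall z, a z = 0.

(** In v t = T~_s t the terms in which [z] has no left descent [i] contribute v b_z T~_z on the
    left, while everything else has degree at most [k]. Comparing coefficients bounds v b_z by
    degree [k]. *)
Lemma eigenvector_coef k N i (b : W -> laurent) t :
  (forall z, z \notin Wc W -> b z = 0) -> (forall z, deg_le k (b z)) ->
  (forall z, b z != 0 -> lat 0 N (tt (s i * z)%g)) ->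
  (forall z, b z != 0 -> lat 0 N (tt z)) ->
  t = \sum_z b z *: tt z -> tt (s i) * t = vX 1 *: t ->
  forall z, ~~ ldesc z i -> deg_le (k - 1) (b z).
Proof.
move=> bc db lat_sz lat_z tE eigen z0 az0.
pose r := \sum_z (b z *: tt (s i * z)%g - (if ldesc z i then (vX (-1) * b z) *: tt z else 0)).
have [a [da sa rE]] : lat k N r.
  apply: lat_sum => z _; have [->|nz] := eqVneq (b z) 0.
    by rewrite mulr0 !scale0r; case: ifP => _; rewrite subrr; exact: lat0.
  apply: latD; first by rewrite -[k]addr0; apply: latZ (lat_sz z nz).
  apply: latN; case: ifP => _; last exact: lat0.
  apply: (@lat_trans (-1 + k + 0) _ N N) => //; first by lia.
  by apply: latZ (lat_z z nz); apply: deg_leM (db z); exact: deg_le_vX.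
pose d z := (if ldesc z i then 0 else vX 1 * b z) - a z.
suff /(_ z0) : forall z, d z = 0.
  rewrite /d (negbTE az0) => /subr0_eq vb; apply: deg_le_vXM; rewrite vb.
  exact: da.
apply: tt_free => [z zc|].
  rewrite /d bc // mulr0 if_same sub0r; apply/eqP; rewrite oppr_eq0.
  by apply: contraNT zc => /sa /andP[].
have : vX 1 *: t - tt (s i) * t = 0 by rewrite eigen subrr.
rewrite {1 2}tE mulr_sumr scaler_sumr -sumrB => sum0.
under eq_bigr => z _ do rewrite /d scalerBl.
rewrite sumrB -rE -sumrB -[RHS]sum0; apply: eq_bigr => z _.
rewrite -scalerAr scalerA; case: ifP => [di|/negbT ai].
  rewrite ttilde_down //; move: (tt z) (tt (s i * z)%g) => p p'.
  rewrite scale0r sub0r scalerDr scalerA mulrBr scalerBl ![_ * b z]mulrC !opprB opprD opprB.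
  by rewrite [RHS]addrC -!addrA addNr addr0 addrC.
by rewrite subr0 ttilde_up.
Qed.

Variable (X : W -> nat -> nat).
Hypotheses (X1 : X 1%g =1 id) (Xs : forall i w, X (s i * w)%g =1 X w \o bswap n i).

(** Multiply the relation of J by T_y, where w = w0 y with w0 longest, and solve for T~_w: the other
    terms carry the negative powers of v given by the length differences. *)
Lemma ttilde_ldesc2 i j w : noncommuting W i j -> ldesc w i -> ldesc w j ->
  (forall x, (ell x < ell w)%N -> lat 0 (ell w).-1 (tt x)) -> lat (-1) (ell w).-1 (tt w).
Proof.
move=> nc di dj lat_lt; have [w0 [y [wE w0P ell_uy lt_w0]]] := ldesc2_parabolic2 X1 Xs nc di dj.
have sum0 : \sum_(u in parabolic2 W i j) vX (ell (u * y)%g)%:Z *: tt (u * y)%g = 0.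
  have : theta TL (\sum_(u in parabolic2 W i j) heckeT H u) = 0.
    by apply/theta_ker => J _; apply; exists i, j.
  move=> /(congr1 (fun t => t * theta TL (heckeT H y))); rewrite mul0r -thetaM mulr_suml.
  rewrite raddf_sum /= => {2}<-; apply: eq_bigr => u uP.
  by rewrite heckeT_mul ?ell_uy // theta_heckeT ell_uy.
have -> : tt w = - \sum_(u in parabolic2 W i j | u != w0)
    vX (- (ell w)%:Z + (ell (u * y)%g)%:Z) *: tt (u * y)%g.
  have := congr1 (fun t => vX (- (ell w)%:Z) *: t) sum0.
  rewrite scaler0 scaler_sumr (bigD1 w0) //= -wE scalerA -vXD addNr scale1r.
  move/eqP; rewrite addr_eq0 => /eqP->; congr (- _).
  by apply: eq_bigr => u _; rewrite scalerA -vXD.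
apply/latN/lat_sum => u /andP[uP ne_u].
have lt_u : (ell (u * y)%g < ell w)%N by rewrite wE !ell_uy // ltn_add2r lt_w0.
rewrite -[-1]addr0; apply: latZ (lat_lt _ lt_u).
by apply: deg_le_trans (@deg_le_vX _); lia.
Qed.

Lemma ttilde_not_fc w : w \notin Wc W -> lat (-1) (ell w).-1 (tt w).
Proof.
have [m] := ubnP (ell w); elim: m w => // m IHm w lt_m wc.
have lat_lt x : (ell x < ell w)%N -> lat 0 (ell x) (tt x).
  move=> lt_x; have [xc|xc] := boolP (x \in Wc W); first exact: lat_ttilde.
  apply: (@lat_trans (-1) _ (ell x).-1) => //; first exact: leq_pred.
  by apply: IHm => //; lia.
have [[i [j [nc di dj]]]|] := not_fc_reduction X1 Xs wc.
  apply: ttilde_ldesc2 nc di dj _ => x lt_x; apply: lat_trans (lat_lt x lt_x) => //.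
  by lia.
case=> i [j [nc di xc dxj w1P]].
set x := (s i * w)%g in xc dxj w1P; set w1 := (s j * x)%g in w1P.
have ell_w : ell w = (ell x).+1 := ldesc_ell di.
have ell_x : ell x = (ell w1).+1 := ldesc_ell dxj.
have ttx : tt (s j) * tt w1 = tt x.
  by rewrite ttilde_up /w1 ?genKl // ldesc_gen dxj.
have [e [de se xE]] : lat (-1) (ell x).-1 (tt x) by apply: IHm => //; rewrite ell_w in lt_m.
(* Coefficients at elements with left descent [i] lie in v^-1 A^-: by induction if [w1] is not fully
   commutative, and otherwise because [w1] does not have this descent. *)
have [d [dd sd w1E w1_coef]] : exists d, [/\ forall z, deg_le 0 (d z),
    forall z, d z != 0 -> (z \in Wc W) && (ell z <= ell w1)%N,
    tt w1 = \sum_z d z *: tt z & forall z, ldesc z i -> deg_le (-1) (d z)].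
  have [w1c|w1c] := boolP (w1 \in Wc W).
    exists (fun z => if z == w1 then 1 else 0); split=> [z|z||z].
    - by case: ifP => _; [exact: deg_le1 | exact: deg_le0].
    - by case: ifP => [/eqP->|_]; rewrite ?w1c ?leqnn ?eqxx.
    - exact: ttilde_delta.
    - case: ifP => [/eqP-> /w1P|_ _]; [by rewrite w1c | exact: deg_le0].
  have [d [dd sd w1E]] : lat (-1) (ell w1).-1 (tt w1) by apply: IHm => //; lia.
  exists d; split=> // z; first exact: deg_le_trans (dd z).
  by move/sd=> /andP[-> /leq_trans->] //; exact: leq_pred.
(* The coefficients of the eigenvector T~_x + v^-1 T~_w1. *)
pose b z := e z + vX (-1) * d z.
have b_supp z : b z != 0 -> (z \in Wc W) && (ell z <= ell w1)%N.
  rewrite /b; have [->|/sd //] := eqVneq (d z) 0.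
  by rewrite mulr0 addr0 => /se; rewrite ell_x.
have lat_sz (l : 'I_n) z : (ell z <= ell w1)%N -> lat 0 (ell x) (tt (s l * z)%g).
  move=> le_z; have le_sz := ell_gen_mul l z.
  by apply: lat_trans (lat_lt _ _) => //; lia.
have b_coef z : ~~ ldesc z j -> deg_le (-1 - 1) (b z).
  apply: (@eigenvector_coef (-1) (ell x) j b (tt x + vX (-1) *: tt w1)) => // {z}.
  - by move=> z zc; apply/eqP; apply: contraNT zc => /b_supp /andP[].
  - by move=> z; apply: deg_leD => //; rewrite -[- 1]addr0; apply: deg_leM (dd z); exact: deg_le_vX.
  - by move=> z /b_supp /andP[_ /lat_sz].
  - move=> z /b_supp /andP[zc le_z]; apply: lat_trans (lat_ttilde zc) => //.
    by rewrite ell_x; exact: leqW.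
  - rewrite {1}xE w1E scaler_sumr -big_split; apply: eq_bigr => z _.
    by rewrite scalerDl scalerA.
  - rewrite mulrDr -[tt (s j) * (_ *: tt w1)]scalerAr ttx.
    rewrite ttilde_down // -/w1; move: (tt x) (tt w1) => p p'.
    rewrite scalerDr scalerA -vXD subrr vX0 scale1r scalerBl -addrA subrK addrC //.
have ttw : tt w = tt (s i) * tt x by rewrite ttilde_up /x ?genKl // ldesc_gen di.
rewrite ttw xE mulr_sumr; apply: lat_sum => z _; rewrite -scalerAr ell_w /=.
have [->|nz] := eqVneq (e z) 0; first by rewrite scale0r; exact: lat0.
have /andP[zc le_z] := se z nz; rewrite ell_x /= in le_z.
have [di_z|ai_z] := boolP (ldesc z i); last first.
  by rewrite ttilde_up // -[-1]addr0; apply: latZ (lat_sz _ _ le_z).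
rewrite ttilde_down // scalerDr; apply: latD.
  by rewrite -[-1]addr0; apply: latZ (lat_sz _ _ le_z).
(* A fully commutative element cannot have both noncommuting left descents. *)
have aj_z : ~~ ldesc z j.
  by apply: contraL zc => dj_z; apply: (not_fc_ldesc2 X1 Xs nc di_z dj_z).
have ez : e z = b z - vX (-1) * d z by rewrite addrK.
(* The coefficient [e z] has degree at most -2 and the factor v - v^-1 has degree 1, leaving -1. *)
rewrite scalerA; apply: (@lat_trans (-1 - 1 + 1 + 0) _ (ell z)) => //.
  by rewrite ell_x; exact: leqW.
apply: latZ (lat_ttilde zc); apply: deg_leM; last first.
  by apply: deg_leB; [exact: deg_le_vX | apply: deg_le_trans (@deg_le_vX _)].
rewrite ez; apply: deg_leB; first exact: b_coef.
by apply: deg_leM (w1_coef z di_z); exact: deg_le_vX.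
Qed.

End Independent.

End Lattice.

(** * Coordinates and spans *)

Section Coordinates.

Variables (R : pzRingType) (M : lmodType R) (I : finType) (b : basis M I).

Lemma coord_sum (J : finType) (a : J -> R) (x : J -> M) i :
  Defs.coord b (\sum_j a j *: x j) i = \sum_j a j * Defs.coord b (x j) i.
Proof.
have -> : \sum_j a j *: x j = \sum_i (\sum_j a j * Defs.coord b (x j) i) *: b i.
  under eq_bigr => j _ do rewrite -{1}[x j](coordK b) scaler_sumr.
  rewrite exchange_big; apply: eq_bigr => k _; rewrite scaler_suml.
  by apply: eq_bigr => j _; rewrite scalerA.
by rewrite bvecK.
Qed.

End Coordinates.

Section Family.

Variables (R : pzRingType) (M : lmodType R) (I : finType) (K : R -> Prop).
Hypotheses (K0 : K 0) (KD : forall a b, K a -> K b -> K (a + b)).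

(** Repeated generators in a list are collected into one coefficient each, which needs only that [K]
    is closed under addition. *)
Lemma lin_span_family (D : {set I}) (f : I -> M) x :
  lin_span K (fun y => exists2 i, i \in D & y = f i) x <->
  exists2 a : I -> R, forall i, K (a i) & x = \sum_(i in D) a i *: f i.
Proof.
split=> [[r rP ->]|[a aK ->]]; last first.
  exists [seq (a i, f i) | i <- enum D] => [_ /mapP[i iD ->]|].
    by split; [exact: aK | exists i => //; rewrite mem_enum in iD].
  by rewrite big_map big_enum.
elim: r rP => [|[k y] r IHr] rP.
  exists (fun=> 0) => //; rewrite big_nil big1 // => i _; exact: scale0r.
have [|a aK sumE] := IHr; first by move=> p pr; apply: rP; rewrite inE pr orbT.
have [/= kK [i iD yE]] := rP (k, y) (mem_head _ _).
exists (fun j => (if j == i then k else 0) + a j) => [j|].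
  by apply: KD (aK j); case: ifP.
rewrite big_cons sumE /= yE; under [RHS]eq_bigr => j _ do rewrite scalerDl.
rewrite big_split /=; congr (_ + _); rewrite (bigD1 i) //= eqxx big1 ?addr0 // => j.
by case/andP=> _ /negbTE->; exact: scale0r.
Qed.

End Family.

(** * Canonical basis and images of the Kazhdan-Lusztig basis *)

Section CanonicalBasis.

Variables (n : nat) (W : coxeter_system (@mB n)) (H : hecke_algebra W).
Variables (TL : temperley_lieb H) (bar : TL -> TL) (c : W -> TL).
Hypotheses (Hbar : is_induced_bar bar) (Hc : is_canonical_basis bar c).
Implicit Types (w x y z : W) (a : W -> laurent) (t : TL).

Local Notation tt := (ttilde TL).

Lemma inLP t : inL t <->
  exists2 a : W -> laurent, forall z, deg_le 0 (a z) & t = \sum_(z in Wc W) a z *: tt z.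
Proof. exact: (@lin_span_family _ _ _ (deg_le 0) (@deg_le0 0) (@deg_leD 0)). Qed.

Lemma inL_canonical t : inL t <->
  exists2 a : W -> laurent, forall z, deg_le 0 (a z) & t = \sum_(z in Wc W) a z *: c z.
Proof.
have [inLE _ _ _] := Hc; apply: iff_trans (inLE t) _.
exact: (@lin_span_family _ _ _ (deg_le 0) (@deg_le0 0) (@deg_leD 0)).
Qed.

Lemma in_vL_canonical t : in_vL t <->
  exists2 a : W -> laurent, forall z, deg_le (-1) (a z) & t = \sum_(z in Wc W) a z *: c z.
Proof.
split=> [[y /inL_canonical[a da ->] ->]|[a da ->]].
  exists (fun z => vX (-1) * a z) => [z|]; first by apply/in_vAnegP; exists (a z) => //; exact: da.
  by rewrite scaler_sumr; apply: eq_bigr => z _; rewrite scalerA.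
exists (\sum_(z in Wc W) (vX 1 * a z) *: c z).
  apply/inL_canonical; exists (fun z => vX 1 * a z) => // z.
  have : deg_le (1 - 1) (vX 1 * a z) by apply: deg_leM (da z); exact: deg_le_vX.
  by rewrite subrr.
by rewrite scaler_sumr; apply: eq_bigr => z _; rewrite scalerA vXK.
Qed.

Lemma deg_le_common a : exists2 k : int, 0 <= k & forall z, deg_le k (a z).
Proof.
have /fin_all_exists[k dk] : forall z, exists k, deg_le k (a z) by move=> z; exact: deg_le_ex.
exists (\sum_z `|k z|); first exact: sumr_ge0.
move=> z; apply: deg_le_trans (dk z); rewrite (bigD1 z) //=.
by apply: (le_trans (ler_norm _)); rewrite lerDl sumr_ge0.
Qed.

(** Multiplication by a power of v^-1 brings all coefficients into A^-, where independence is
    given. *)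
Lemma canonical_free a :
  \sum_(z in Wc W) a z *: c z = 0 -> forall z, z \in Wc W -> a z = 0.
Proof.
have [_ c_free _ _] := Hc; have [k k_ge0 dk] := deg_le_common a => sum0 z zc.
have scaled0 : \sum_(w in Wc W) (vX (- k) * a w) *: c w = 0.
  have := congr1 (fun t => vX (- k) *: t) sum0; rewrite scaler0 scaler_sumr => {2}<-.
  by apply: eq_bigr => w _; rewrite scalerA.
have deg0 w : deg_le 0 (vX (- k) * a w).
  by rewrite -(addNr k); apply: deg_leM (dk w); exact: deg_le_vX.
by rewrite -(vXK (- k) (a z)) (c_free _ deg0 scaled0 z zc) mulr0.
Qed.

(** The transition matrix to the canonical basis is the identity modulo v^-1, so each coefficient is
    a combination of all coefficients with factors in v^-1 A^-. Any common degree bound can thus be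
    lowered indefinitely. *)
Lemma ttilde_free a : (forall z, z \notin Wc W -> a z = 0) ->
  \sum_z a z *: tt z = 0 -> forall z, a z = 0.
Proof.
have [_ _ _ c_pi] := Hc; move=> supp_a sum0.
have sumWc : \sum_(z in Wc W) a z *: tt z = 0.
  rewrite big_mkcond -[RHS]sum0; apply: eq_bigr => z _.
  by case: ifPn => // zc; rewrite supp_a // scale0r.
have /fin_all_exists[d dP] : forall z, exists d : W -> laurent, z \in Wc W ->
    (forall w, deg_le (-1) (d w)) /\ tt z = c z - \sum_(w in Wc W) d w *: c w.
  move=> z; have [zc|] := boolP (z \in Wc W); last by exists (fun=> 0).
  have /in_vL_canonical[d dd dE] := c_pi z zc; exists d => _; split=> //.
  by rewrite -dE opprB addrC subrK.
have a_eq w : w \in Wc W -> a w = \sum_(z in Wc W) a z * d z w.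
  move=> wc; apply: subr0_eq.
  apply: (canonical_free (a := fun w => a w - \sum_(z in Wc W) a z * d z w)) wc.
  rewrite -[RHS]sumWc.
  under eq_bigr => x _ do rewrite scalerBl scaler_suml.
  rewrite sumrB exchange_big -sumrB; apply: eq_bigr => z zc.
  have [_ ->] := dP z zc; rewrite scalerBr scaler_sumr; congr (_ - _).
  by apply: eq_bigr => x _; rewrite scalerA.
have [k _ dk] := deg_le_common a => z0; apply: deg_le_all => l.
suff deg_a (m : nat) z : deg_le (k - m%:Z) (a z).
  by apply: deg_le_trans (deg_a `|k - l|%N z0); lia.
elim: m z => [|m IHm] z; first by rewrite subr0.
have [zc|/supp_a->] := boolP (z \in Wc W); last exact: deg_le0.
rewrite a_eq // big_mkcond; apply: deg_le_sum => w.
case: ifP => [wc|_]; last exact: deg_le0.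
by apply: (@deg_le_trans (k - m%:Z - 1)); [lia | apply: deg_leM (IHm w) _; have [] := dP w wc].
Qed.

Lemma barH_sum (I : finType) (b : I -> laurent) (h : I -> H) :
  barH (\sum_i b i *: h i) = \sum_i barA (b i) *: barH (h i).
Proof.
rewrite /barH; under eq_bigr => w _ do rewrite coord_sum rmorph_sum scaler_suml.
rewrite exchange_big; apply: eq_bigr => i _; rewrite scaler_sumr.
by apply: eq_bigr => w _; rewrite rmorphM scalerA.
Qed.

Lemma theta_sum (I : finType) (P : pred I) (b : I -> laurent) (h : I -> H) :
  theta TL (\sum_(i | P i) b i *: h i) = \sum_(i | P i) b i *: theta TL (h i).
Proof. by rewrite linear_sum; apply: eq_bigr => i _; rewrite linearZ. Qed.

Lemma bar_sum (b : W -> laurent) (f : W -> TL) :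
  bar (\sum_w b w *: f w) = \sum_w barA (b w) *: bar (f w).
Proof.
have /fin_all_exists[h hE] : forall w, exists h, theta TL h = f w by move=> w; exact: theta_surj.
under eq_bigr => w _ do rewrite -hE.
rewrite -theta_sum Hbar barH_sum theta_sum; apply: eq_bigr => w _.
by rewrite -Hbar hE.
Qed.

(** By independence of [c] the coordinates of [t] are bar-invariant; their exponents are all
    negative, so they vanish. *)
Lemma bar_fixed_vL t : in_vL t -> bar t = t -> t = 0.
Proof.
have [_ _ c_bar _] := Hc; case/in_vL_canonical=> a da tE bar_t.
suff a0 z : z \in Wc W -> a z = 0.
  by rewrite tE big1 // => z zc; rewrite a0 // scale0r.
move=> zc; apply: (deg_le_barA (da z)); apply: subr0_eq.
apply: (canonical_free (a := fun z => barA (a z) - a z)) zc.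
under eq_bigr => w _ do rewrite scalerBl.
rewrite sumrB -tE -bar_t tE; apply/eqP; rewrite subr_eq0; apply/eqP.
(* Padding with zeros gives a sum over all of [W], to which [bar_sum] applies, without involving [c]
   outside [Wc W]. *)
transitivity (bar (\sum_w (if w \in Wc W then a w else 0) *: c w)).
  rewrite bar_sum big_mkcond; apply: eq_bigr => w _; case: ifP => wc.
    by rewrite c_bar.
  by rewrite raddf0 scale0r.
congr bar; rewrite [RHS]big_mkcond; apply: eq_bigr => w _.
by case: ifP => // _; rewrite scale0r.
Qed.

Lemma latP k N t : lat k N t -> exists2 a : W -> laurent, forall z, deg_le k (a z) &
  t = \sum_(z in Wc W) a z *: tt z.
Proof.
case=> a [da sa ->]; exists a => //; rewrite [RHS]big_mkcond; apply: eq_bigr => z _.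
case: ifPn => // zc; have [->|/sa/andP[/(negP zc)]] // := eqVneq (a z) 0.
by rewrite scale0r.
Qed.

Lemma lat_in_vL N t : lat (-1) N t -> in_vL t.
Proof.
case/latP=> a da ->; exists (\sum_(z in Wc W) (vX 1 * a z) *: tt z).
  apply/inLP; exists (fun z => vX 1 * a z) => // z.
  have : deg_le (1 - 1) (vX 1 * a z) by apply: deg_leM (da z); exact: deg_le_vX.
  by rewrite subrr.
by rewrite scaler_sumr; apply: eq_bigr => z _; rewrite scalerA vXK.
Qed.

Variables (C : basis H W).
Hypothesis HC : is_KL_basis C.

(** Every T~_x maps into the lattice, and the coefficients below the leading one lie in v^-1 A^-;
    only the leading term matters, and it vanishes modulo v^-1 when [w] is not fully commutative. *)
Lemma theta_KL_vL w : in_vL (theta TL (C w) - (if w \in Wc W then tt w else 0)).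
Proof.
have [X [X1 Xs]] := position_action W; pose N := \max_(x : W) ell x.
have lat_nfc x : x \notin Wc W -> lat (-1) N (tt x).
  move=> xc; apply: lat_trans (ttilde_not_fc ttilde_free X1 Xs xc) => //.
  exact: leq_trans (leq_pred _) (leq_bigmax _).
have lat_tt x : lat 0 N (tt x).
  have [xc|/lat_nfc] := boolP (x \in Wc W); last exact: lat_trans.
  by apply: lat_trans (@lat_ttilde _ _ _ TL _ xc) => //; exact: leq_bigmax.
have [_ [P [-> dP Pw P0 Plt]]] := HC w.
rewrite theta_sum (bigD1 w) //= Pw scale1r addrAC; apply: (@lat_in_vL N); apply: latD.
  rewrite /Ttilde linearZ -/(ttilde TL w); case: ifPn => [_|/lat_nfc]; rewrite ?subrr ?subr0 //.
  exact: lat0.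
apply: lat_sum => x ne_xw; rewrite /Ttilde linearZ -/(ttilde TL x) -[-1]addr0.
apply: latZ (lat_tt x); have [le_x|nle_x] := boolP (bruhat_le x w).
  by apply/in_vAnegP/Plt; rewrite /bruhat_lt ne_xw.
by rewrite P0 //; exact: deg_le0.
Qed.

Lemma bar_theta_KL w : bar (theta TL (C w)) = theta TL (C w).
Proof. by rewrite Hbar; have [-> _] := HC w. Qed.

Lemma theta_KL w : theta TL (C w) = if w \in Wc W then c w else 0.
Proof.
have [_ _ c_bar c_pi] := Hc; have := theta_KL_vL w; case: ifPn => [wc|wc] vL_w; last first.
  by rewrite subr0 in vL_w; apply: bar_fixed_vL vL_w (bar_theta_KL w).
apply: subr0_eq; apply: bar_fixed_vL.
  have /in_vL_canonical[a da aE] := vL_w; have /in_vL_canonical[b db bE] := c_pi w wc.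
  apply/in_vL_canonical; exists (fun z => a z - b z) => [z|]; first exact: deg_leB.
  under eq_bigr => z _ do rewrite scalerBl.
  by rewrite sumrB -aE -bE opprB addrA subrK.
(* Semilinearity for a family indexed by [bool], with coefficients 1 and -1, treats the difference
   of [C w] and a lift of [c w]. *)
have [h hE] := theta_surj (c w); have := barH_sum (fun b : bool => if b then 1 else -1)
  (fun b => if b then C w else h).
rewrite !big_bool /= rmorphN !rmorph1 !scale1r !scaleN1r => barHB.
have thetaB (f g : H) : theta TL (f - g) = theta TL f - theta TL g by rewrite raddfB.
by rewrite -hE -thetaB Hbar barHB !thetaB -!Hbar bar_theta_KL hE c_bar.
Qed.

(** Applying [theta] to the expansion of [g] leaves a relation among the [c w], whose coefficients
    must vanish. *)
Lemma inJ_coord (g : H) w : inJ g -> w \in Wc W -> Defs.coord C g w = 0.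
Proof.
move=> /(theta_ker TL) gJ wc; rewrite -{1}(coordK C g) theta_sum in gJ.
apply: canonical_free wc; rewrite -[RHS]gJ big_mkcond; apply: eq_bigr => z _.
by rewrite theta_KL; case: ifP; rewrite ?scaler0.
Qed.

Lemma inJ_KL (g : H) : inJ g -> g = \sum_(w in ~: Wc W) Defs.coord C g w *: C w.
Proof.
move=> gJ; rewrite -{1}(coordK C g) (bigID (mem (~: Wc W))) /=.
rewrite [X in _ + X = _]big1 ?addr0 // => w; rewrite inE negbK => wc.
by rewrite inJ_coord ?scale0r.
Qed.

Lemma KL_inJ w : w \notin Wc W -> inJ (C w).
Proof. by move=> wc; apply/(theta_ker TL); rewrite theta_KL (negbTE wc). Qed.

Lemma lin_span_inJ (S : H -> Prop) (g : H) :
  lin_span (fun=> True) S g -> (forall h, S h -> inJ h) -> inJ g.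
Proof.
move=> [r rP ->] SJ; apply/(theta_ker TL); elim: r rP => [|[a h] r IHr] rP.
  by rewrite big_nil raddf0.
rewrite big_cons raddfD /= IHr => [|p pr]; last by apply: rP; rewrite inE pr orbT.
have [_ /SJ/(theta_ker TL) h0] := rP _ (mem_head _ _).
by rewrite linearZ /= h0 scaler0 addr0.
Qed.

End CanonicalBasis.

Section Cells.

Variables (T : finType) (r : rel T).

Lemma union_of_cells_closed (D : {set T}) :
  reflexive r -> (forall x y, x \in D -> r y x && r x y -> y \in D) -> union_of_cells r D.
Proof.
move=> r_refl closedD; exists [set [set y | r x y && r y x] | x in D].
  by apply/subsetP => _ /imsetP[x _ ->]; apply: imset_f.
apply/setP => x; apply/idP/bigcupP => [xD | [_ /imsetP[y yD ->]]].
  by exists [set y | r x y && r y x]; [exact: imset_f | rewrite inE r_refl].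
by rewrite inE andbC => /(closedD _ _ yD).
Qed.

Lemma closed_under_connect (D : {set T}) : closed_under r D -> closed_under (connect r) D.
Proof.
move=> closedD x y xD /connectP[p yp xE]; rewrite {}xE in xD.
elim: p y yp xD => //= z p IHp y /andP[r_yz zp] lastD.
exact: closedD (IHp z zp lastD) r_yz.
Qed.

End Cells.

(** * Inversion and the equivalent conditions *)

Lemma fully_commutativeV (n : nat) (W : coxeter_system (@mB n)) (w : W) :
  fully_commutative w^-1%g = fully_commutative w.
Proof.
suff imp (x : W) : ~~ fully_commutative x -> ~~ fully_commutative x^-1%g.
  by apply: negb_inj; apply/idP/idP => [/imp|/imp]; rewrite ?invgK.
rewrite /fully_commutative.
move=> /negPn/existsP[i /existsP[j /existsP[x1 /existsP[u /existsP[x2]]]]].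
case/and4P=> nc /andP[uP u_max] /eqP xE /eqP ell_x.
apply/negPn/existsP; exists i; apply/existsP; exists j; apply/existsP; exists x2^-1%g.
apply/existsP; exists u^-1%g; apply/existsP; exists x1^-1%g.
rewrite nc /longest groupV uP !ellV u_max ell_x xE !invMg mulgA eqxx /=.
by rewrite addnC addnA addnAC addnC addnA.
Qed.

Theorem theorem3p1p1 (n : nat) (W : coxeter_system (@mB n))
    (H : hecke_algebra W) (C : basis H W) (HC : is_KL_basis C)
    (TL : temperley_lieb H)
    (bar : TL -> TL) (Hbar : is_induced_bar bar)
    (c : W -> TL) (Hc : is_canonical_basis bar c) :
  (* (i) *)
  (forall x : H, inJ x <->
     lin_span (fun=> True) (fun h => inJ h /\ exists w, h = C w) x) /\
  (* (ii) *)
  (forall x : H, inJ x <->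
     lin_span (fun=> True) (fun h => exists2 w, w \in ~: Wc W & h = C w) x) /\
  (* (iii) *)
  (forall w, w \in ~: Wc W -> theta TL (C w) = 0) /\
  (* (iv) *)
  (forall w, [/\ inL (theta TL (C w)),
                 w \in Wc W -> pi_eq (theta TL (C w)) (c w)
               & w \notin Wc W -> pi_eq (theta TL (C w)) 0]) /\
  (* (v) *)
  (forall w, w \in ~: Wc W -> in_vL (theta TL (Ttilde H w))) /\
  (* (vi) *)
  (closed_under (leL C) (~: Wc W) /\ union_of_cells (leL C) (~: Wc W)) /\
  (* (vii) *)
  (closed_under (leLR C) (~: Wc W) /\ union_of_cells (leLR C) (~: Wc W)) /\
  (* (viii), which is also the final assertion *)
  (closed_under (geLR C) (Wc W) /\ union_of_cells (leLR C) (Wc W)).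

Proof.
have [X [X1 Xs]] := position_action W.
have thetaC := theta_KL Hbar Hc HC.
(* Serves (i) and (ii) at once, for any [S] containing these basis elements. *)
have spanJ (S : H -> Prop) (g : H) : (forall w, w \in ~: Wc W -> S (C w)) -> inJ g ->
    lin_span (fun=> True) S g.
  move=> SC /(inJ_KL Hbar Hc HC) gE.
  exists [seq (Defs.coord C g w, C w) | w <- enum (~: Wc W)].
    by move=> _ /mapP[w wc ->]; split=> //; apply: SC; rewrite mem_enum in wc.
  by rewrite {1}gE big_map big_enum.
have CJ w : w \in ~: Wc W -> inJ (C w) by rewrite in_setC => /(KL_inJ Hbar Hc HC).
(* The product of [C (gen W i)] with an element of J stays in J, hence has no coordinate on
   [Wc W]. *)
have stepL : closed_under (leL C) (~: Wc W).
  apply: closed_under_connect => x y xc /existsP[i /andP[_]].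
  apply: contraNT; rewrite in_setC negbK => yc; apply/eqP; apply: (inJ_coord Hbar Hc HC) yc.
  apply/(theta_ker TL); rewrite thetaM; have /(theta_ker TL) -> := CJ x xc.
  by rewrite mulr0.
(* The right preorder is transported by inversion, which preserves full commutativity. *)
have stepR : closed_under (leR C) (~: Wc W).
  move=> x y; rewrite !inE -fully_commutativeV -(fully_commutativeV y) => xc yx.
  by have := stepL x^-1%g y^-1%g; rewrite !inE; apply.
have stepLR : closed_under (leLR C) (~: Wc W).
  by apply: closed_under_connect => x y xc /orP[]; [apply: stepL | apply: stepR].
have closed_geLR : closed_under (geLR C) (Wc W).
  move=> x y xc le_xy; apply: contraLR xc => yc; have := stepLR y x.
  by rewrite !inE in yc *; apply.
split; [|split; [|split; [|split; [|split; [|split; [|split]]]]]].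
- move=> g; split; first by apply: spanJ => w wc; split; [exact: CJ | exists w].
  by move/(lin_span_inJ TL); apply=> h [].
- move=> g; split; first by apply: spanJ => w wc; exists w.
  by move/(lin_span_inJ TL); apply=> h [w wc ->]; exact: CJ.
- by move=> w; rewrite in_setC thetaC => /negbTE->.
- have vL0 : in_vL (0 : TL).
    exists 0; last by rewrite scaler0.
    by exists [::]; rewrite ?big_nil.
  move=> w; rewrite thetaC; split; last by move=> /negbTE->; rewrite /pi_eq subr0.
    case: ifPn => [wc|_]; last by exists [::]; rewrite ?big_nil.
    have [inLE _ _ _] := Hc; apply/inLE; exists [:: (1, c w)].
      move=> _ /[!inE] /eqP->; split; last by exists w.
      exact: deg_le1.
    by rewrite big_seq1 scale1r.
  by move=> ->; rewrite /pi_eq subrr.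
- move=> w; rewrite in_setC => wc.
  have : in_vL (ttilde TL w).
    exact: lat_in_vL (ttilde_not_fc (ttilde_free Hc) X1 Xs wc).
  by rewrite /Ttilde linearZ.
- split=> //; apply: union_of_cells_closed => [x|x y xc /andP[yx _]]; first exact: connect0.
  exact: stepL xc yx.
- split=> //; apply: union_of_cells_closed => [x|x y xc /andP[yx _]]; first exact: connect0.
  exact: stepLR xc yx.
- split=> //; apply: union_of_cells_closed => [x|x y xc /andP[_ yx]]; first exact: connect0.
  exact: closed_geLR xc yx.
Qed.
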